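(* \textsc{Path Discovery} and \textsc{Shortest Path Discovery} in the token jumping model are solvable in polynomial time.
   Context: Two-graph model. An instance is $(G,M,s,t,S,b)$ where $G$ (the problem graph) is a directed graph with integer edge weights $w_G\colon E(G)\to\mathbb Z$ and no negative-weight cycle, $M$ (the movement graph) is a directed graph on the same vertex set $V$ with nonnegative integer edge weights, $s,t\in V$ are distinct, $S$ is a multiset of vertices (the initial token configuration), and $b\in\mathbb Z$ is the budget. A move takes a token at $x$ and an edge $(x,y)\in E(M)$ and relocates the token to $y$ at cost $w_M(x,y)$. A configuration $T$ is reachable from $S$ within budget $b$ if some sequence of moves transforms $S$ into $T$ with total cost at most $b$. An $s$-$t$ path is a sequence of pairwise distinct vertices $s=v_0,\dots,v_\ell=t$ with consecutive pairs being edges of $G$; a shortest one has minimum total $w_G$-weight. \textsc{Path Discovery} asks whether some $T$ reachable from $S$ within budget $b$ contains the vertex set of some $s$-$t$ path of $G$; \textsc{Shortest Path Discovery} asks the same for a shortest $s$-$t$ path. The token jumping model is the special case where $M$ is the complete bidirected graph on $V$ with all edge weights equal to $1$. *)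

(* Defs.v *)
(* MathComp, with finmap for multisets *)
From HB Require Import structures.
From mathcomp Require Import all_boot all_order all_algebra.
From mathcomp Require Import finmap multiset.

Set Implicit Arguments.
Unset Strict Implicit.
Unset Printing Implicit Defensive.

Import Order.TTheory GRing.Theory Num.Theory.
Local Open Scope ring_scope.
Local Open Scope mset_scope.

(** * Token discovery in the two-graph model *)

(* [weight u v] is meaningful only when [edge u v] holds. *)
Record wdigraph (V : finType) := WDigraph {
  edge : rel V;
  weight : V -> V -> int
}.

Fixpoint walk_weight (V : finType) (G : wdigraph V) (x : V) (p : seq V) : int :=
  if p is y :: p' then weight G x y + walk_weight G y p' else 0.

Definition cycle_weight (V : finType) (G : wdigraph V) (p : seq V) : int :=
  if p is x :: p' then walk_weight G x (rcons p' x) else 0.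

Definition no_negative_cycle (V : finType) (G : wdigraph V) : Prop :=
  forall p : seq V, ucycle (edge G) p -> 0 <= cycle_weight G p.

Definition nonnegative_weights (V : finType) (M : wdigraph V) : Prop :=
  forall x y : V, edge M x y -> 0 <= weight M x y.

Record instance := Instance {
  num_vertices : nat;
  problem_graph : wdigraph 'I_num_vertices;
  movement_graph : wdigraph 'I_num_vertices;
  source : 'I_num_vertices;
  target : 'I_num_vertices;
  tokens : {mset 'I_num_vertices};
  budget : int;
  problem_graphP : no_negative_cycle problem_graph;
  movement_graphP : nonnegative_weights movement_graph;
  source_neq_target : source != target
}.

(* [moves M S c T]: some sequence of moves of total cost [c] turns [S] into [T]. *)
Inductive moves (V : finType) (M : wdigraph V) (S : {mset V}) :
    int -> {mset V} -> Prop :=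
| moves_nil : moves M S 0 S
| moves_rcons (c : int) (T : {mset V}) (x y : V) :
    moves M S c T -> x \in T -> edge M x y ->
    moves M S (c + weight M x y) (y +` (T `\ x)).

Definition reachable (V : finType) (M : wdigraph V) (S : {mset V}) (b : int)
    (T : {mset V}) : Prop :=
  exists2 c : int, c <= b & moves M S c T.

(* [p] lists the vertices of the path after [s]. *)
Definition st_path (V : finType) (G : wdigraph V) (s t : V) (p : seq V) : Prop :=
  [/\ path (edge G) s p, uniq (s :: p) & last s p = t].

Definition shortest_st_path (V : finType) (G : wdigraph V) (s t : V)
    (p : seq V) : Prop :=
  st_path G s t p /\
  forall q : seq V, st_path G s t q -> walk_weight G s p <= walk_weight G s q.

Definition path_discovery (I : instance) : Prop :=
  exists2 T, reachable (movement_graph I) (tokens I) (budget I) T &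
  exists2 p, st_path (problem_graph I) (source I) (target I) p &
             {subset source I :: p <= T}.

Definition shortest_path_discovery (I : instance) : Prop :=
  exists2 T, reachable (movement_graph I) (tokens I) (budget I) T &
  exists2 p, shortest_st_path (problem_graph I) (source I) (target I) p &
             {subset source I :: p <= T}.

Definition token_jumping (I : instance) : Prop :=
  forall x y : 'I_(num_vertices I),
    edge (movement_graph I) x y = (x != y) /\
    (x != y -> weight (movement_graph I) x y = 1).

(** * Polynomial time: random access machines with logarithmic cost *)

(* Length of the binary representation of |z|, with [bitlen 0 = 1]. *)
Definition bitlen (z : int) : nat := (trunc_log 2 `|z|%N).+1.

Definition input_size (w : seq int) : nat := sumn [seq bitlen z | z <- w].

(* Cells are addressed by arbitrary integers; the cells with negative address
   are initially 0 and available as working space. *)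
Definition memory := int -> int.

Definition update (m : memory) (a v : int) : memory :=
  fun z => if z == a then v else m z.

(* Cell 0 holds the length of the input, cells 1, 2, ... its entries. *)
Definition initial_memory (w : seq int) : memory :=
  fun z => if z is Posz i then (Posz (size w) :: w)`_i else 0.

Inductive expr :=
| Const of int
| Cell of expr
| Add of expr & expr
| Sub of expr & expr
| Mul of expr & expr.

Fixpoint eval (m : memory) (e : expr) : int :=
  match e with
  | Const z => z
  | Cell e1 => m (eval m e1)
  | Add e1 e2 => eval m e1 + eval m e2
  | Sub e1 e2 => eval m e1 - eval m e2
  | Mul e1 e2 => eval m e1 * eval m e2
  end.

(* Every operation is charged the bit length of its operands, and every memory
   access the bit lengths of the address and of the content. *)
Fixpoint eval_cost (m : memory) (e : expr) : nat :=
  match e with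
  | Const z => bitlen z
  | Cell e1 =>
      (eval_cost m e1 + bitlen (eval m e1) + bitlen (m (eval m e1)))%N
  | Add e1 e2 | Sub e1 e2 | Mul e1 e2 =>
      (eval_cost m e1 + eval_cost m e2
       + bitlen (eval m e1) + bitlen (eval m e2))%N
  end.

Inductive cmd :=
| Skip
| Store of expr & expr   (* address, value *)
| Seq of cmd & cmd
| If of expr & cmd & cmd
| While of expr & cmd.

(* [exec c m m' k]: started on memory [m], the program [c] halts with memory
   [m'] after time [k]. A test succeeds when its expression is positive. *)
Inductive exec : cmd -> memory -> memory -> nat -> Prop :=
| exec_skip m : exec Skip m m 1
| exec_store m a e :
    exec (Store a e) m (update m (eval m a) (eval m e))
      (eval_cost m a + eval_cost m e + bitlen (eval m a) + bitlen (eval m e))%N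
| exec_seq c1 c2 m m1 m2 k1 k2 :
    exec c1 m m1 k1 -> exec c2 m1 m2 k2 -> exec (Seq c1 c2) m m2 (k1 + k2)%N
| exec_if_true e c1 c2 m m' k :
    0 < eval m e -> exec c1 m m' k ->
    exec (If e c1 c2) m m' (eval_cost m e + k)%N
| exec_if_false e c1 c2 m m' k :
    eval m e <= 0 -> exec c2 m m' k ->
    exec (If e c1 c2) m m' (eval_cost m e + k)%N
| exec_while_false e c m :
    eval m e <= 0 -> exec (While e c) m m (eval_cost m e)
| exec_while_true e c m m1 m2 k1 k2 :
    0 < eval m e -> exec c m m1 k1 -> exec (While e c) m1 m2 k2 ->
    exec (While e c) m m2 (eval_cost m e + k1 + k2)%N.

(* The instances are those [x : A] with [D x], presented to the machine as
   [enc x]; the answer is left in cell 0. *)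
Definition solvable_in_ptime (A : Type) (enc : A -> seq int) (D Q : A -> Prop) :
    Prop :=
  exists (c : cmd) (p : {poly nat}), forall x : A, D x ->
  exists (m : memory) (k : nat),
    [/\ exec c (initial_memory (enc x)) m k,
        (k <= p.[input_size (enc x)])%N,
        Q x -> m 0 = 1 &
        ~ Q x -> m 0 = 0].

(** * Encoding of instances *)

(* Adjacency matrix in row-major order, two entries per ordered pair:
   the edge flag, and the weight (0 in the absence of an edge). *)
Definition encode_graph (n : nat) (G : wdigraph 'I_n) : seq int :=
  flatten [seq (if edge G x y then [:: 1; weight G x y] else [:: 0; 0])
          | x <- enum 'I_n, y <- enum 'I_n].

(* The token configuration is given by its vector of multiplicities. *)
Definition encode (I : instance) : seq int :=
  [:: Posz (num_vertices I); Posz (source I); Posz (target I); budget I]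
  ++ [seq Posz (tokens I x) | x <- enum 'I_(num_vertices I)]
  ++ encode_graph (problem_graph I)
  ++ encode_graph (movement_graph I).

(* Main.v *)
(* Since every jump costs 1, the vertex set of a path p can be covered within
   budget b iff p has at most |S| vertices and at most b of them bare, that is,
   outside the support of S. In the absence of negative cycles, cutting a cycle
   out of a walk increases neither its weight, nor its number of bare vertices,
   nor its length, so walks can replace paths. For each number i < n of edges and
   each vertex v, dynamic programming finds an s-v walk with i edges minimising
   (n + 1) * weight + #bare, i.e. the lexicographic minimum of (weight, #bare) as
   far as paths are concerned. The answer is positive iff for some i < |S| the
   entry of t has the least weight of all rows and at most b bare vertices.
   Multiplying the weights by 0 turns the shortest path problem into the path
   problem, so one program, with a coefficient 0 or 1, serves for both.

   A single bound on the number of bits of all cells makes the running time a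
   function of the program text, all of whose loops run n times. *)
Require Import Defs.
From mathcomp Require Import all_boot all_order all_algebra.
From mathcomp Require Import finmap multiset.
From mathcomp Require Import zify ring.
(* [eqtype] shadows the constructor [Sub] of [expr]. *)
Import Defs.

Set Implicit Arguments.
Unset Strict Implicit.
Unset Printing Implicit Defensive.

Import Order.TTheory GRing.Theory Num.Theory.
Local Open Scope mset_scope.
Local Open Scope ring_scope.

(** * Bit lengths and running times *)

Lemma bitlen_leP (z : int) (k : nat) :
  (0 < k)%N -> (bitlen z <= k)%N = (`|z| < 2 ^ k)%N.
Proof.
case: k => // k _; rewrite /bitlen ltnS.
have [->|z0] := posnP `|z|%N; first by rewrite trunc_log0 expn_gt0.
apply/idP/idP => [lek|ltz].
  by apply: leq_trans (trunc_log_ltn _ (ltnSn 1)) _; rewrite leq_exp2l.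
by rewrite -ltnS -(@ltn_exp2l 2) //; apply: leq_ltn_trans (trunc_logP _ _) ltz.
Qed.

Lemma ltn_bitlen (z : int) : (`|z| < 2 ^ bitlen z)%N.
Proof. by rewrite -bitlen_leP. Qed.

(** Numbers [X] and [Y] that are at least 2 satisfy [X + Y <= X * Y]. The coarse bound [a + b] lets
    sums and products share one rule in [expr_width]. *)
Lemma bitlenD_le (x y : int) (a b : nat) :
  (bitlen x <= a)%N -> (bitlen y <= b)%N -> (bitlen (x + y) <= a + b)%N.
Proof.
move=> xa yb.
have a0 : (0 < a)%N by apply: leq_trans xa.
have b0 : (0 < b)%N by apply: leq_trans yb.
rewrite bitlen_leP ?addn_gt0 ?a0 //.
rewrite bitlen_leP // in xa; rewrite bitlen_leP // in yb.
have a2 : (2 <= 2 ^ a)%N by rewrite -{1}(expn1 2) leq_exp2l.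
have b2 : (2 <= 2 ^ b)%N by rewrite -{1}(expn1 2) leq_exp2l.
rewrite expnD; move: (2 ^ a)%N (2 ^ b)%N xa yb a2 b2 => X Y *.
have : (X + Y <= X * Y)%N by nia.
lia.
Qed.

Lemma bitlenN (x : int) : bitlen (- x) = bitlen x.
Proof. by rewrite /bitlen abszN. Qed.

Lemma bitlenM_le (x y : int) (a b : nat) :
  (bitlen x <= a)%N -> (bitlen y <= b)%N -> (bitlen (x * y) <= a + b)%N.
Proof.
move=> xa yb.
have a0 : (0 < a)%N by apply: leq_trans xa.
have b0 : (0 < b)%N by apply: leq_trans yb.
rewrite bitlen_leP ?addn_gt0 ?a0 //.
rewrite bitlen_leP // in xa; rewrite bitlen_leP // in yb.
by rewrite abszM expnD ltn_mul.
Qed.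

Definition bounded_by (B : nat) (m : memory) : Prop :=
  forall z, (bitlen (m z) <= B)%N.

Fixpoint expr_width (B : nat) (e : expr) : nat :=
  match e with
  | Const z => bitlen z
  | Cell _ => B
  | Add e1 e2 | Sub e1 e2 | Mul e1 e2 => expr_width B e1 + expr_width B e2
  end.

Fixpoint expr_time (B : nat) (e : expr) : nat :=
  match e with
  | Const z => bitlen z
  | Cell e1 => expr_time B e1 + expr_width B e1 + B
  | Add e1 e2 | Sub e1 e2 | Mul e1 e2 =>
      expr_time B e1 + expr_time B e2 + expr_width B e1 + expr_width B e2
  end.

(* Worst-case time of a program all of whose loops make at most [n] iterations
   and whose cells never exceed [B] bits. *)
Fixpoint cmd_time (n B : nat) (c : cmd) : nat :=
  match c with
  | Skip => 1
  | Store a e =>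
      expr_time B a + expr_time B e + expr_width B a + expr_width B e
  | Seq c1 c2 => cmd_time n B c1 + cmd_time n B c2
  | If e c1 c2 => expr_time B e + (cmd_time n B c1 + cmd_time n B c2)
  | While e c1 => n * (expr_time B e + cmd_time n B c1) + expr_time B e
  end.

Lemma bitlen_eval (B : nat) (m : memory) (e : expr) :
  bounded_by B m -> (bitlen (eval m e) <= expr_width B e)%N.
Proof.
move=> mB; elim: e => //= [e1 IH1 e2 IH2|e1 IH1 e2 IH2|e1 IH1 e2 IH2].
- exact: bitlenD_le.
- by apply: bitlenD_le; rewrite ?bitlenN.
- exact: bitlenM_le.
Qed.

Lemma eval_cost_le (B : nat) (m : memory) (e : expr) :
  bounded_by B m -> (eval_cost m e <= expr_time B e)%N.
Proof.
move=> mB; have W e' := bitlen_eval e' mB.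
by elim: e => //= *; rewrite !leq_add ?W.
Qed.

(** * Total correctness with time bounds *)

(** A Hoare-style judgement of total correctness. Its time bound depends on the program text, [n]
    and [B] alone, so postconditions need not mention time; the bound on the cells is restored, so
    that judgements compose. *)
Definition terminates (n B : nat) (c : cmd) (m : memory)
    (Q : memory -> Prop) : Prop :=
  bounded_by B m ->
  exists m' k, [/\ exec c m m' k, bounded_by B m', (k <= cmd_time n B c)%N & Q m'].

Lemma terminates_skip n B m (Q : memory -> Prop) : Q m -> terminates n B Skip m Q.
Proof. by move=> Qm mB; exists m, 1%N; split=> //; constructor. Qed.

Lemma terminates_store n B m a e (Q : memory -> Prop) :
  (bitlen (eval m e) <= B)%N -> Q (update m (eval m a) (eval m e)) ->
  terminates n B (Store a e) m Q.
Proof.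
move=> eB Qm mB; exists (update m (eval m a) (eval m e)).
eexists; split; [exact: exec_store| |rewrite /=|exact: Qm].
  by move=> z; rewrite /update; case: ifP.
by rewrite !leq_add ?bitlen_eval ?eval_cost_le.
Qed.

Lemma terminates_seq n B m c1 c2 (Q : memory -> Prop) :
  terminates n B c1 m (fun m1 => terminates n B c2 m1 Q) ->
  terminates n B (Seq c1 c2) m Q.
Proof.
move=> t1 mB; have [m1 [k1 [e1 m1B k1T t2]]] := t1 mB.
have [m2 [k2 [e2 m2B k2T Qm]]] := t2 m1B.
exists m2, (k1 + k2)%N; split=> //; first exact: exec_seq e1 e2.
exact: leq_add.
Qed.

Lemma terminates_if n B m e c1 c2 (Q : memory -> Prop) :
  (0 < eval m e -> terminates n B c1 m Q) ->
  (eval m e <= 0 -> terminates n B c2 m Q) ->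
  terminates n B (If e c1 c2) m Q.
Proof.
move=> t1 t2 mB; have eT := eval_cost_le e mB.
have [e0|e0] := ltP 0 (eval m e).
  have [m' [k [ex m'B kT Qm]]] := t1 e0 mB; exists m', (eval_cost m e + k)%N.
  by split=> //=; [exact: exec_if_true | lia].
have [m' [k [ex m'B kT Qm]]] := t2 e0 mB; exists m', (eval_cost m e + k)%N.
by split=> //=; [exact: exec_if_false | lia].
Qed.

Lemma terminates_imp n B c m (P Q : memory -> Prop) :
  (forall m', P m' -> Q m') -> terminates n B c m P -> terminates n B c m Q.
Proof.
move=> PQ t mB; have [m' [k [ex m'B kT Pm]]] := t mB.
by exists m', k; split=> //; apply: PQ.
Qed.

(** [Inv i] describes the memory after [i] iterations. The guard holds while [i < N] and fails at
    [N], so there are exactly [N] iterations; this settles termination and time at once. *)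
Lemma terminates_while n B e c (N : nat) (Inv : nat -> memory -> Prop)
    (Q : memory -> Prop) :
  (N <= n)%N ->
  (forall i m, (i < N)%N -> Inv i m -> 0 < eval m e) ->
  (forall m, Inv N m -> eval m e <= 0) ->
  (forall i m, (i < N)%N -> Inv i m -> terminates n B c m (Inv i.+1)) ->
  (forall m, Inv N m -> Q m) ->
  forall m, Inv 0%N m -> terminates n B (While e c) m Q.
Proof.
move=> leNn guard stop step post.
(* Induction on the number [d] of iterations still to come. *)
suff loop d i m : (i + d = N)%N -> Inv i m -> bounded_by B m ->
    exists m' k, [/\ exec (While e c) m m' k, bounded_by B m',
      (k <= d * (expr_time B e + cmd_time n B c) + expr_time B e)%N & Q m'].
  move=> m I0 mB; have [m' [k [ex m'B kT Qm]]] := loop N 0%N m (add0n _) I0 mB.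
  exists m', k; split=> //=; apply: leq_trans kT _.
  by rewrite leq_add2r leq_mul2r leNn orbT.
elim: d i m => [|d IH] i m.
  rewrite addn0 => -> IN mB; exists m, (eval_cost m e); split=> //.
  - by apply: exec_while_false; apply: stop.
  - exact: eval_cost_le.
  - exact: post.
move=> idN Im mB; have ltiN : (i < N)%N by lia.
have [m1 [k1 [e1 m1B k1T I1]]] := step i m ltiN Im mB.
have [|m2 [k2 [e2 m2B k2T Qm]]] := IH i.+1 m1 _ I1 m1B; first by lia.
exists m2, (eval_cost m e + k1 + k2)%N; split=> //.
  by apply: exec_while_true e1 e2; apply: guard ltiN Im.
have := eval_cost_le e mB; lia.
Qed.

(* The loop bound is the content of cell 1, the number of vertices. *)
Definition For (v : int) (c : cmd) : cmd :=
  Seq (Store (Const v) (Const 0))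
      (While (Sub (Cell (Const 1)) (Cell (Const v)))
             (Seq c (Store (Const v) (Add (Cell (Const v)) (Const 1))))).

(** The invariant is asserted once the counter has been reset or advanced; the body itself must
    leave the counter alone. *)
Lemma terminates_for n B v c m (Inv : nat -> memory -> Prop) (Q : memory -> Prop) :
  (bitlen n%:Z <= B)%N ->
  (forall i m, Inv i m -> m 1 = n%:Z) ->
  Inv 0%N (update m v 0) ->
  (forall i m, (i < n)%N -> Inv i m -> m v = i%:Z ->
     terminates n B c m (fun m' => m' v = i%:Z /\ Inv i.+1 (update m' v i.+1%:Z))) ->
  (forall m, Inv n m -> Q m) ->
  terminates n B (For v c) m Q.
Proof.
move=> nB bound init step post.
have B0 : (0 < B)%N by apply: leq_trans nB.
apply/terminates_seq/terminates_store => /=; first by rewrite bitlen_leP ?expn_gt0.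
pose Inv' i m := Inv i m /\ m v = i%:Z.
apply: (@terminates_while _ _ _ _ n Inv') => //.
- by move=> i m1 lti [/bound /= -> ->]; lia.
- by move=> m1 [/bound /= -> ->]; lia.
- move=> i m1 lti [Im mv]; apply: terminates_seq.
  apply: terminates_imp (step i m1 lti Im mv) => m2 [m2v I2].
  apply: terminates_store => /=; rewrite m2v addrC -intS.
    by rewrite bitlen_leP //= in nB; rewrite bitlen_leP //; apply: leq_ltn_trans nB.
  by split=> //; rewrite /update eqxx.
- by move=> m1 [/post].
- by split=> //; rewrite /update eqxx.
Qed.

(** * Polynomial bounds on running times *)

Definition poly_bounded (f : nat -> nat) : Prop :=
  exists p : {poly nat}, forall x, (f x <= p.[x])%N.

Lemma poly_bounded_cst k : poly_bounded (fun _ => k).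
Proof. by exists (k%:P) => x; rewrite hornerC. Qed.

Lemma poly_bounded_id : poly_bounded id.
Proof. by exists 'X => x; rewrite hornerX. Qed.

Lemma poly_boundedD f g :
  poly_bounded f -> poly_bounded g -> poly_bounded (fun x => f x + g x)%N.
Proof.
by move=> [p fp] [q gq]; exists (p + q) => x; rewrite hornerD; apply: leq_add.
Qed.

Lemma poly_boundedM f g :
  poly_bounded f -> poly_bounded g -> poly_bounded (fun x => f x * g x)%N.
Proof.
by move=> [p fp] [q gq]; exists (p * q) => x; rewrite hornerM; apply: leq_mul.
Qed.

Lemma poly_bounded_expr_width B e :
  poly_bounded B -> poly_bounded (fun x => expr_width (B x) e).
Proof.
move=> pB; elim: e => //= [z|e1 IH1 e2 IH2|e1 IH1 e2 IH2|e1 IH1 e2 IH2].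
- exact: poly_bounded_cst.
- exact: poly_boundedD.
- exact: poly_boundedD.
- exact: poly_boundedD.
Qed.

Lemma poly_bounded_expr_time B e :
  poly_bounded B -> poly_bounded (fun x => expr_time (B x) e).
Proof.
move=> pB; have W := poly_bounded_expr_width _ pB.
elim: e => //= [z|e1 IH1|e1 IH1 e2 IH2|e1 IH1 e2 IH2|e1 IH1 e2 IH2].
- exact: poly_bounded_cst.
- by do !apply: poly_boundedD => //.
- by do !apply: poly_boundedD => //.
- by do !apply: poly_boundedD => //.
- by do !apply: poly_boundedD => //.
Qed.

(** [cmd_time] is built from constants, the loop bound and the cell width by sums and products only,
    so induction on the program yields a polynomial. *)
Lemma poly_bounded_cmd_time N B c : poly_bounded N -> poly_bounded B ->
  poly_bounded (fun x => cmd_time (N x) (B x) c).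
Proof.
move=> pN pB; have W := poly_bounded_expr_width _ pB.
have T := poly_bounded_expr_time _ pB.
elim: c => /= [|a e|c1 IH1 c2 IH2|e c1 IH1 c2 IH2|e c1 IH1].
- exact: poly_bounded_cst.
- by do !apply: poly_boundedD => //.
- exact: poly_boundedD.
- by do !apply: poly_boundedD => //.
- by apply: poly_boundedD => //; apply: poly_boundedM => //; apply: poly_boundedD.
Qed.

Lemma cmd_time_mono n n' B c : (n <= n')%N -> (cmd_time n B c <= cmd_time n' B c)%N.
Proof.
move=> len; elim: c => //= *; rewrite ?leq_add //.
by rewrite leq_mul // leq_add.
Qed.

(** * Token jumping *)

(* Naming the coercion to functions keeps its implicit arguments uniform, which
   [lia] needs in order to recognise equal multiplicities. *)
Definition multiplicity (V : finType) (S : {mset V}) (x : V) : nat := S x.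

Definition num_tokens (V : finType) (S : {mset V}) : nat :=
  (\sum_x multiplicity S x)%N.

Lemma mem_mset (V : finType) (T : {mset V}) (z : V) :
  (z \in T) = (0 < multiplicity T z)%N.
Proof. exact: in_mset. Qed.

Lemma move_mset (V : finType) (T : {mset V}) (x y z : V) :
  multiplicity (y +` (T `\ x)) z = ((z == y) + (multiplicity T z - (z == x)))%N.
Proof. by rewrite /multiplicity mset1DE msetB1E. Qed.

Lemma num_tokens_move (V : finType) (T : {mset V}) (x y : V) :
  x \in T -> num_tokens (y +` (T `\ x))%mset = num_tokens T.
Proof.
rewrite mem_mset => Tx.
have one (u : V) : (\sum_z (z == u) = 1)%N.
  by rewrite (bigD1 u) //= eqxx big1 // => z /negbTE ->.
(* Adding an indicator sum on either side avoids the truncated subtraction in [move_mset]. *)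
suff : (num_tokens (y +` (T `\ x)) + \sum_z (z == x)
        = num_tokens T + \sum_z (z == y))%N by rewrite !one; lia.
rewrite -!big_split /=; apply: eq_bigr => z _.
by rewrite move_mset; case: (z =P x) => [->|_]; lia.
Qed.

Section TokenJumping.
Variables (V : finType) (M : wdigraph V).
Hypothesis jumping :
  forall x y, edge M x y = (x != y) /\ (x != y -> weight M x y = 1).

(** A jump costs 1 and adds at most one vertex, its destination, to the support, so the cost bounds
    the number of vertices of [p] newly covered. *)
Lemma moves_token_jumping (S T : {mset V}) (c : int) (p : seq V) :
  uniq p -> moves M S c T ->
  num_tokens T = num_tokens S /\
  (count (fun x => (x \notin S) && (x \in T)) p)%:Z <= c.
Proof.
move=> Up; elim=> {c T} [|c T x y _ [sz IH] Tx xy].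
  by split=> //; rewrite (eq_count (a2 := pred0)) ?count_pred0 // => x; rewrite andNb.
have [exy wxy] := jumping x y; rewrite wxy -?exy //.
split; first by rewrite num_tokens_move.
set a := (X in (count X p)%:Z <= c) in IH.
apply: (@le_trans _ _ (count a p + 1)%:Z); last by rewrite PoszD lerD2r.
rewrite lez_nat.
(* A vertex newly covered after the jump was so before or is [y], and [y] occurs at most once in
   [p]. *)
apply: leq_trans (_ : _ <= count (predU a (pred1 y)) p)%N _.
  apply: sub_count => z /= /andP[zS]; rewrite /a zS /= !mem_mset move_mset.
  by case: (z == y) => /=; rewrite ?orbT //; case: (z == x) => /=; lia.
apply: leq_trans (_ : _ <= count a p + count (pred1 y) p)%N _.
  by rewrite -count_predUI leq_addr.
by rewrite leq_add2l count_uniq_mem ?leq_b1.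
Qed.

(** Bare vertices of [p] are covered one at a time, each by a jump with a token that [p] can spare:
    one off [p], or a second one at a vertex of [p]. The induction is on the number of bare
    vertices. *)
Lemma gather_tokens (S T : {mset V}) (c : int) (p : seq V) :
  uniq p -> moves M S c T -> (size p <= num_tokens T)%N ->
  exists2 T', moves M S (c + (count (fun x => x \notin T) p)%:Z) T' &
              {subset p <= T'}.
Proof.
move=> Up; move Em : (count _ p) => m; elim: m c T Em => [|m IH] c T Em mT pT.
  exists T; first by rewrite addr0.
  move=> x px; apply/negPn/negP => xT.
  have : has (fun x => x \notin T) p by apply/hasP; exists x.
  by rewrite has_count Em.
have /hasP[x px xT] : has (fun x => x \notin T) p by rewrite has_count Em.
(* Since some vertex of [p] is bare, some token is spare by pigeonhole. *)
have [y Ty] : exists y, (y \in p < multiplicity T y)%N.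
  apply/existsP; apply: contraT => /existsPn nT.
  suff : (num_tokens T < size p)%N by lia.
  have -> : size p = (\sum_z (z \in p))%N.
    by rewrite -sum1_size big_uniq //= -big_mkcond.
  (* Without a spare token, each multiplicity is at most the indicator of [p], and strictly smaller
     at the bare vertex [x]. *)
  rewrite [num_tokens T](bigD1 x) //= [X in (_ < X)%N](bigD1 x) //= px.
  have -> : multiplicity T x = 0%N by move: xT; rewrite mem_mset; lia.
  rewrite add0n add1n ltnS leq_sum // => z _; rewrite leqNgt; exact: nT.
have yx : y != x.
  by apply: contraNneq xT => <-; rewrite mem_mset; lia.
have [exy wxy] := jumping y x.
have mT' : moves M S (c + weight M y x) (x +` (T `\ y))%mset.
  by apply: moves_rcons; rewrite ?exy // mem_mset; lia.
rewrite wxy // in mT'.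
have yT : y \in T by rewrite mem_mset; lia.
have [||T' mT'' sT'] := IH _ _ _ mT'.
(* The jump removes exactly [x] from the bare vertices: if [y] lies on [p], it keeps a token. *)
- have /eqP := count_predC (fun z => (z == x)) [seq z <- p | z \notin T].
  rewrite size_filter Em !count_filter.
  have -> : count (predI (xpred1 x) (fun z => z \notin T)) p = 1%N.
    transitivity (count_mem x p); last by rewrite count_uniq_mem ?px.
    by apply: eq_count => z /=; case: eqP => // ->.
  rewrite add1n eqSS => /eqP <-; apply: eq_in_count => z pz /=.
  rewrite !mem_mset move_mset.
  case: eqP => [_|_] /=; first by lia.
  by case: eqP => [E|_]; [move: Ty; rewrite -E pz|]; lia.
- by rewrite num_tokens_move.
by exists T' => //; rewrite (_ : c + m.+1%:Z = c + 1 + m%:Z) //; lia.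
Qed.

Lemma reachable_cover (S : {mset V}) (b : int) (p : seq V) :
  uniq p ->
  (exists2 T, reachable M S b T & {subset p <= T}) <->
  (size p <= num_tokens S)%N /\ (count (fun x => x \notin S) p)%:Z <= b.
Proof.
move=> Up; split=> [[T [c cb mT] pT]|[sz cb]].
  have [<- le_c] := moves_token_jumping Up mT; split; last first.
    apply: le_trans cb; apply: le_trans le_c; rewrite lez_nat.
    rewrite (eq_in_count (a2 := fun x => (x \notin S) && (x \in T))) //.
    by move=> x /pT ->; rewrite andbT.
  rewrite -sum1_size big_uniq //= /num_tokens big_mkcond leq_sum //= => x _.
  by case: ifP => // /pT; rewrite mem_mset.
have [T mT pT] := gather_tokens Up (moves_nil M S) sz.
by rewrite add0r in mT; exists T => //; exists (count (fun x => x \notin S) p)%:Z.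
Qed.

End TokenJumping.

(** * Shortening walks *)

Lemma walk_weight_cat (V : finType) (G : wdigraph V) (x : V) (p q : seq V) :
  walk_weight G x (p ++ q) = walk_weight G x p + walk_weight G (last x p) q.
Proof. by elim: p x => [|y p IH] x /=; rewrite ?add0r // IH addrA. Qed.

Lemma walk_weight_rcons (V : finType) (G : wdigraph V) (x : V) (p : seq V) (y : V) :
  walk_weight G x (rcons p y) = walk_weight G x p + weight G (last x p) y.
Proof. by rewrite -cats1 walk_weight_cat /= addr0. Qed.

(** Take the last position from which the walk still repeats a vertex. What follows is free of
    repetitions, so the loop back to that vertex is a simple cycle, as [ucycle] demands. *)
Lemma not_uniq_split (V : eqType) (s : V) (p : seq V) : ~~ uniq (s :: p) ->
  exists p1 p2 p3, p = p1 ++ rcons p2 (last s p1) ++ p3 /\ uniq (last s p1 :: p2).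
Proof.
elim: p s => //= x p IH s; have [/IH|/negPn Up] := boolP (~~ uniq (x :: p)).
  by move=> [p1 [p2 [p3 [-> Uy]]]] _; exists (x :: p1), p2, p3.
rewrite -[(x \notin p) && uniq p]/(uniq (x :: p)) Up andbT negbK.
move=> /splitPr xp; case: xp Up => p2 p3 Up.
exists [::], p2, p3; split; first by rewrite cat_rcons.
by move: Up; rewrite -cat_rcons cat_uniq rcons_uniq => /andP[].
Qed.

(** Only simple cycles are assumed to have nonnegative weight, so they are cut out one by one, by
    induction on the length. *)
Lemma shorten_walk (V : finType) (G : wdigraph V) (a : pred V) (s : V) (p : seq V) :
  no_negative_cycle G -> path (edge G) s p ->
  exists q, [/\ st_path G s (last s p) q, walk_weight G s q <= walk_weight G s p,
    (size q <= size p)%N & (count a (s :: q) <= count a (s :: p))%N].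
Proof.
move=> nonneg; have [k] := ubnP (size p); elim: k p => // k IH p szp Pp.
have [Up|nUp] := boolP (uniq (s :: p)); first by exists p; split.
have [p1 [p2 [p3 [E Uc]]]] := not_uniq_split nUp.
set y := last s p1 in E Uc; rewrite E in szp *; move: Pp; rewrite E.
rewrite !cat_path last_rcons => /and3P[P1 P2 P3].
have [||q [stq wq zq cq]] := IH (p1 ++ p3).
- by move: szp; rewrite !size_cat size_rcons; lia.
- by rewrite cat_path P1.
exists q; split.
- by move: stq; rewrite !last_cat last_rcons.
- apply: le_trans wq _; rewrite !walk_weight_cat last_rcons lerD2l lerDr.
  by apply: (nonneg (y :: p2)); rewrite /ucycle /= P2.
- by apply: leq_trans zq _; rewrite !size_cat; lia.
- by apply: leq_trans cq _; rewrite /= !count_cat; lia.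
Qed.

(** * Walks with a given number of edges *)

Section Walks.
Variables (n : nat) (G : wdigraph 'I_n) (a : pred 'I_n) (s : 'I_n).

(* [a] marks the vertices without token. As a path has at most [n] of them, the
   factor [n + 1] orders paths by weight first. *)
Definition walk_key (w c : int) : int := n.+1%:Z * w + c.

Definition num_marked (p : seq 'I_n) : int := (count a (s :: p))%:Z.

(* [f] flags whether [P] is inhabited; [w] and [c] are the weight and the number
   of marked vertices of an element of [P] of minimum key. *)
Definition best (P : seq 'I_n -> Prop) (f w c : int) : Prop :=
  (f = 0 /\ forall p, ~ P p) \/
  (f = 1 /\ exists p, [/\ P p, w = walk_weight G s p, c = num_marked p &
     forall q, P q -> walk_key w c <= walk_key (walk_weight G s q) (num_marked q)]).

Definition walk (i : nat) (v : 'I_n) (p : seq 'I_n) : Prop :=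
  [/\ path (edge G) s p, size p = i & last s p = v].

(** The candidates examined for entry [v] of row [i + 1] after trying the predecessors below [u];
    for [u = n] these are all walks with [i + 1] edges to [v]. *)
Definition walk_via (i u : nat) (v : 'I_n) (p : seq 'I_n) : Prop :=
  exists (x : 'I_n) q, [/\ p = rcons q v, (x < u)%N, edge G x v & walk i x q].

Lemma best_iff P Q f w c : (forall p, P p <-> Q p) -> best P f w c -> best Q f w c.
Proof.
move=> PQ [[f0 nP]|[f1 [p [Pp wp cp mp]]]]; [left|right]; split=> //.
  by move=> p /PQ /nP.
by exists p; split=> //; [apply/PQ | move=> q /PQ /mp].
Qed.

Lemma best_flag P f w c : best P f w c -> f = 0 \/ f = 1.
Proof. by case=> [[-> _]|[-> _]]; [left|right]. Qed.

(** This lemma and the next are the two outcomes of comparing an old optimum with a new candidate: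
    keep or replace. *)
Lemma best_unionl P Q f w c w' c' : best P f w c -> best Q 1 w' c' ->
  f = 1 -> walk_key w c <= walk_key w' c' ->
  best (fun p => P p \/ Q p) f w c.
Proof.
move=> [[-> //]|[f1 [p [Pp wp cp mp]]]] [[//]|[_ [q [Qq wq cq mq]]]] _ le_wc.
right; split=> //; exists p; split=> //; first by left.
by move=> r [/mp //|/mq]; apply: le_trans.
Qed.

Lemma best_unionr P Q f w c w' c' : best P f w c -> best Q 1 w' c' ->
  f = 0 \/ walk_key w' c' <= walk_key w c ->
  best (fun p => P p \/ Q p) 1 w' c'.
Proof.
move=> bP [[//]|[_ [q [Qq wq cq mq]]]] le_wc.
right; split=> //; exists q; split=> //; first by right.
move=> r [Pr|/mq //].
case: bP le_wc => [[_ /(_ r)] //|[-> [p [_ _ _ mp]]] [//|le_wc]].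
by apply: le_trans le_wc (mp r Pr).
Qed.

(** A fixed last edge adds the same amount to the key of every walk to [x], so minimality survives.
    The result is again a walk, though an extended path need not be a path. *)
Lemma best_rcons i (x v : 'I_n) w c : edge G x v -> best (walk i x) 1 w c ->
  best (fun p => exists2 q, p = rcons q v & walk i x q) 1
       (w + weight G x v) (c + (a v)%:Z).
Proof.
move=> xv [[//]|[_ [p [Wp wp cp mp]]]]; right; split=> //.
have rc q : walk i x q ->
    walk_key (walk_weight G s (rcons q v)) (num_marked (rcons q v)) =
    walk_key (walk_weight G s q) (num_marked q) + walk_key (weight G x v) (a v).
  move=> [_ _ lq]; rewrite walk_weight_rcons lq /num_marked /walk_key -rcons_cons.
  by rewrite -cats1 count_cat /= addn0 PoszD; ring.
have [_ _ lp] := Wp.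
exists (rcons p v); split; first by exists p.
- by rewrite walk_weight_rcons lp wp.
- by rewrite cp /num_marked -rcons_cons -cats1 count_cat /= addn0 PoszD.
move=> _ [q -> Wq]; rewrite rc //; have := mp q Wq; rewrite /walk_key; lia.
Qed.

Lemma best_relax_skip i (x v : 'I_n) f w c f' w' c' :
  best (walk_via i x v) f w c -> best (walk i x) f' w' c' ->
  f' = 0 \/ ~~ edge G x v -> best (walk_via i x.+1 v) f w c.
Proof.
move=> bP bQ no; apply: best_iff bP => p; split=> -[y [q [-> yx yv Wq]]].
  by exists y, q; split=> //; apply: leqW.
exists y, q; split=> //; rewrite ltn_neqAle -ltnS yx andbT; apply/negP => /eqP E.
have {}E : y = x by apply: val_inj.
rewrite {y yx}E in yv Wq; case: no => [f0|]; last by rewrite yv.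
by case: bQ => [[_ /(_ q)]|[]] //; rewrite f0.
Qed.

Lemma walk_viaS i (x v : 'I_n) p : edge G x v ->
  walk_via i x.+1 v p <->
  walk_via i x v p \/ (exists2 q, p = rcons q v & walk i x q).
Proof.
move=> xv; split=> [[y [q [-> yx yv Wq]]]|[[y [q [-> yx yv Wq]]]|[q -> Wq]]].
- move: yx; rewrite ltnS leq_eqVlt => /orP[/eqP/val_inj E|yx]; last first.
    by left; exists y, q.
  by right; exists q => //; rewrite -E.
- by exists y, q; split=> //; apply: leqW.
- by exists x, q.
Qed.

(** All candidates end in [v], so its mark cancels in the comparison. Hence here and in
    [best_relax_set] the count [c] omits [v]. *)
Lemma best_relax_keep i (x v : 'I_n) w c w' c' :
  edge G x v ->
  best (walk_via i x v) 1 w (c + (a v)%:Z) -> best (walk i x) 1 w' c' ->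
  walk_key w c <= walk_key (w' + weight G x v) c' ->
  best (walk_via i x.+1 v) 1 w (c + (a v)%:Z).
Proof.
move=> xv bP /(best_rcons xv) bQ le_wc.
apply: best_iff (best_unionl bP bQ erefl _) => [p|].
  by split=> /(walk_viaS _ _ xv).
by move: le_wc; rewrite /walk_key; lia.
Qed.

Lemma best_relax_set i (x v : 'I_n) f w c w' c' :
  edge G x v ->
  best (walk_via i x v) f w (c + (a v)%:Z) -> best (walk i x) 1 w' c' ->
  f = 0 \/ walk_key (w' + weight G x v) c' <= walk_key w c ->
  best (walk_via i x.+1 v) 1 (w' + weight G x v) (c' + (a v)%:Z).
Proof.
move=> xv bP /(best_rcons xv) bQ le_wc.
apply: best_iff (best_unionr bP bQ _) => [p|].
  by split=> /(walk_viaS _ _ xv).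
by case: le_wc => [|le_wc]; [left|right; move: le_wc; rewrite /walk_key; lia].
Qed.

Lemma best_via0 i v w c : best (walk_via i 0 v) 0 w c.
Proof. by left; split=> // p [x [q [_]]]. Qed.

Lemma best_via_all i v f w c : best (walk_via i n v) f w c -> best (walk i.+1 v) f w c.
Proof.
apply: best_iff => p; split=> [[x [q [-> _ xv [Pq zq lq]]]]|[]].
  by split; rewrite ?rcons_path ?Pq ?lq ?size_rcons ?zq ?last_rcons.
case/lastP: p => // q y; rewrite rcons_path size_rcons last_rcons.
by move=> /andP[Pq ey] [zq] <-; exists (last s q), q; split.
Qed.

Lemma best_walk0 (v : 'I_n) : best (walk 0 v) (v == s)%:Z 0 (a s)%:Z.
Proof.
have [->|vs] := eqVneq v s; [right|left]; split=> //.
  exists [::]; split=> //; first by rewrite /num_marked /= addn0.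
  by move=> q [_ /size0nil -> _]; rewrite /num_marked /= addn0.
by move=> p [_ /size0nil ->] /= sv; rewrite sv eqxx in vs.
Qed.

(** * Shortest paths read off the optimal walks to [t] *)

Variables (t : 'I_n) (F W C : nat -> int).
Hypothesis nonneg : no_negative_cycle G.
Hypothesis rows : forall i, (i < n)%N -> best (walk i t) (F i) (W i) (C i).

Lemma size_st_path p : st_path G s t p -> (size p < n)%N.
Proof.
move=> [_ Up _]; rewrite -[X in (_ < X)%N](card_ord n).
by rewrite -[(size p).+1]/(size (s :: p)) -(card_uniqP Up) max_card.
Qed.

(** The path [p] competes in row [size p] and has at most [n] marked vertices, so comparing keys
    gives [(n + 1) * (W - w) <= n] for its weight [w]. Hence [W <= w], and equal weights leave a
    comparison of the counts. *)
Lemma row_st_path p : st_path G s t p ->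
  [/\ F (size p) = 1, W (size p) <= walk_weight G s p &
      W (size p) = walk_weight G s p -> C (size p) <= num_marked p].
Proof.
move=> stp; have szp := size_st_path stp; have [Pp Up lp] := stp.
have Wp : walk (size p) t p by [].
case: (rows szp) => [[_ /(_ p)] //|[-> [q [Wq _ Eq min]]]]; have := min p Wp.
have : 0 <= C (size p) by rewrite Eq /num_marked.
have : num_marked p <= n%:Z.
  by rewrite lez_nat; apply: leq_trans (count_size _ _) _.
rewrite /walk_key => ? ? ?; split=> //; last by move=> E; move: E; nia.
rewrite -ltzD1; nia.
Qed.

Variables (k : nat) (b d : int).
Hypothesis d_le : forall i, (i < n)%N -> F i = 1 -> d <= W i.
Hypothesis d_eq : (forall i, (i < n)%N -> F i <> 1) \/
  exists i, [/\ (i < n)%N, F i = 1 & d = W i].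

(** Here [d] is the least weight among the rows, and arbitrary if [t] is unreachable. A shortest
    path makes its own row optimal; conversely the walk of an optimal row shortens to a path, of
    weight at most [d] and thus shortest. A path with [i] edges has [i + 1] vertices, whence
    [i < k]. *)
Lemma rows_shortest_st_path :
  (exists2 p, shortest_st_path G s t p & (size p < k)%N /\ num_marked p <= b) <->
  exists i, [/\ (i < n)%N, F i = 1, W i = d, C i <= b & (i < k)%N].
Proof.
split=> [[p [stp minp] [pk cb]]|[i [ltin Fi Wi Ci ik]]].
  have szp := size_st_path stp; have [Fp leW leC] := row_st_path stp.
  (* The walk of any row shortens to a path, so no row undercuts [p]. *)
  have walk_ge i : (i < n)%N -> F i = 1 -> walk_weight G s p <= W i.
    move=> ltin Fi; case: (rows ltin) => [[]|[_ [q [[Pq _ lq] -> _ _]]]].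
      by rewrite Fi.
    have [r [str wr _ _]] := shorten_walk a nonneg Pq.
    by rewrite lq in str; apply: le_trans (minp r str) wr.
  have Wp : W (size p) = walk_weight G s p.
    by apply/le_anti; rewrite leW walk_ge.
  exists (size p); split=> //; last by apply: le_trans (leC Wp) cb.
  apply/le_anti; rewrite d_le // andbT.
  case: d_eq => [/(_ _ szp)//|[i [ltin Fi ->]]].
  by rewrite Wp walk_ge.
case: (rows ltin) => [[]|[_ [p [[Pp zp lp] wp cp _]]]]; first by rewrite Fi.
have [q [stq wq zq cq]] := shorten_walk a nonneg Pp; rewrite lp in stq.
exists q; last first.
  split; first by apply: leq_ltn_trans ik; rewrite -zp.
  by apply: le_trans Ci; rewrite cp lez_nat.
split=> // r str; have szr := size_st_path str; have [Fr leW _] := row_st_path str.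
apply: le_trans wq _; rewrite -wp Wi; apply: le_trans leW; exact: d_le.
Qed.

End Walks.

(** * The program *)

Lemma update_same (m : memory) (a v : int) : update m a v a = v.
Proof. by rewrite /update eqxx. Qed.

Lemma update_other (m : memory) (a v z : int) : z <> a -> update m a v z = m z.
Proof. by rewrite /update => /eqP/negbTE ->. Qed.

Definition var (k : int) : expr := Cell (Const k).

(** Cells 1 to 4 hold the number of vertices, the source, the target and the budget; the
    multiplicities start at cell 5. *)
Definition token_at (x : expr) : expr := Cell (Add (Const 5) x).

Definition edge_address (x y : expr) : expr :=
  Add (Add (Const 5) (var 1)) (Mul (Const 2) (Add (Mul x (var 1)) y)).

(** The table lies below the scratch cells -1 to -9, with three cells per entry: flag, weight and
    number of marked vertices for [k] = 0, 1, 2. *)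
Definition table_address (k : int) (i v : expr) : expr :=
  Sub (Const (- 10 - k)) (Mul (Const 3) (Add (Mul i (var 1)) v)).

Definition table (k : int) (i v : expr) : expr := Cell (table_address k i v).

(* Cells -1, -2, -3 are the loop counters, -4, -5, -6 hold the flag, weight and
   number of marked vertices of the table entry being computed, -7 the number
   of tokens, -8 and -9 the flag and value of the minimum weight, and cell 0
   the answer. *)
Definition count_tokens : cmd :=
  Seq (Store (Const (-7)) (Const 0))
      (For (-3) (Store (Const (-7)) (Add (var (-7)) (token_at (var (-3)))))).

(** Negative cells are initially 0, so only the nonzero cells of row 0 are written. *)
Definition first_row : cmd :=
  Seq (Store (table_address 0 (Const 0) (var 2)) (Const 1))
      (If (token_at (var 2)) Skip
          (Store (table_address 2 (Const 0) (var 2)) (Const 1))).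

Definition extended_weight (f : int) : expr :=
  Add (table 1 (var (-1)) (var (-3)))
      (Mul (Const f) (Cell (Add (edge_address (var (-3)) (var (-2))) (Const 1)))).

Definition set_entry (f : int) : cmd :=
  Seq (Store (Const (-4)) (Const 1))
  (Seq (Store (Const (-5)) (extended_weight f))
       (Store (Const (-6)) (table 2 (var (-1)) (var (-3))))).

(** The product of two flags is their conjunction, and the innermost test is on the old key minus
    the new one, so ties keep the old entry. *)
Definition relax (f : int) : cmd :=
  If (Mul (table 0 (var (-1)) (var (-3))) (Cell (edge_address (var (-3)) (var (-2)))))
     (If (Sub (Const 1) (var (-4))) (set_entry f)
         (If (Add (Mul (Add (var 1) (Const 1)) (Sub (var (-5)) (extended_weight f)))
                  (Sub (var (-6)) (table 2 (var (-1)) (var (-3)))))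
             (set_entry f) Skip))
     Skip.

Definition next_row_address (k : int) : expr :=
  table_address k (Add (var (-1)) (Const 1)) (var (-2)).

Definition compute_entry (f : int) : cmd :=
  Seq (Store (Const (-4)) (Const 0))
  (Seq (Store (Const (-5)) (Const 0))
  (Seq (Store (Const (-6)) (Const 0))
  (Seq (For (-3) (relax f))
  (Seq (Store (next_row_address 0) (var (-4)))
  (Seq (Store (next_row_address 1) (var (-5)))
       (If (token_at (var (-2)))
           (Store (next_row_address 2) (var (-6)))
           (Store (next_row_address 2) (Add (var (-6)) (Const 1))))))))).

Definition fill_table (f : int) : cmd := For (-1) (For (-2) (compute_entry f)).

Definition store_minimum : cmd :=
  Seq (Store (Const (-8)) (Const 1))
      (Store (Const (-9)) (table 1 (var (-1)) (var 3))).

Definition minimum_weight : cmd :=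
  Seq (Store (Const (-8)) (Const 0))
      (For (-1) (If (table 0 (var (-1)) (var 3))
                    (If (Sub (Const 1) (var (-8))) store_minimum
                        (If (Sub (var (-9)) (table 1 (var (-1)) (var 3)))
                            store_minimum Skip))
                    Skip)).

Definition decide : cmd :=
  Seq (Store (Const 0) (Const 0))
      (For (-1) (If (table 0 (var (-1)) (var 3))
                    (If (Sub (table 1 (var (-1)) (var 3)) (var (-9))) Skip
                        (If (Sub (table 2 (var (-1)) (var 3)) (var 4)) Skip
                            (If (Sub (var (-7)) (var (-1))) (Store (Const 0) (Const 1))
                                Skip)))
                    Skip)).

Definition discovery_program (f : int) : cmd :=
  Seq count_tokens (Seq first_row (Seq (fill_table f) (Seq minimum_weight decide))).

(** * Correctness of the program *)

Section Program.
Variables (n : nat) (G : wdigraph 'I_n) (f : int) (s t : 'I_n) (b : int).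
Variables (S : 'I_n -> nat) (m0 : memory) (A X B : nat).
Hypothesis m0_n : m0 1 = n%:Z.
Hypothesis m0_s : m0 2 = s%:Z.
Hypothesis m0_t : m0 3 = t%:Z.
Hypothesis m0_b : m0 4 = b.
Hypothesis m0_S : forall x : 'I_n, m0 (5 + x%:Z) = (S x)%:Z.
Hypothesis m0_edge : forall x y : 'I_n,
  m0 (5 + n%:Z + 2 * (x%:Z * n%:Z + y%:Z)) = (edge G x y)%:Z.
Hypothesis m0_weight : forall x y : 'I_n, edge G x y ->
  f * m0 (5 + n%:Z + 2 * (x%:Z * n%:Z + y%:Z) + 1) = weight G x y.
Hypothesis m0_neg : forall z : int, z < 0 -> m0 z = 0.
Hypothesis weight_le : forall x y : 'I_n, edge G x y -> `|weight G x y| <= A%:Z.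
Hypothesis n_small : (n < X)%N.
Hypothesis w_small : (n * A <= X)%N.
Hypothesis S_small : (\sum_x S x <= X)%N.
Hypothesis X_small : (X < 2 ^ B)%N.

Let marked : pred 'I_n := fun x => S x == 0%N.

(** [X] bounds all stored numbers: counters, token totals, weights of walks with at most [n] edges
    of weight at most [A], and counts of marked vertices. The latter reach [n + 1] in row [n], hence
    the strict [n < X]. *)
Lemma small_bitlen (z : int) : `|z| <= X%:Z -> (bitlen z <= B)%N.
Proof.
move=> zX; rewrite bitlen_leP; first by apply: leq_ltn_trans X_small; lia.
by case: B X_small n_small => //; rewrite expn0; lia.
Qed.

Definition cell_address (k : int) (i : nat) (v : 'I_n) : int :=
  - 10 - k - 3 * (i%:Z * n%:Z + v%:Z).

(** [k] is a remainder modulo 3, and [i], [v] are quotient and remainder of a division by [n]. *)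
Lemma cell_address_inj (k k' : int) (i i' : nat) (v v' : 'I_n) :
  0 <= k < 3 -> 0 <= k' < 3 ->
  cell_address k i v = cell_address k' i' v' -> [/\ k = k', i = i' & v = v'].
Proof.
rewrite /cell_address => kk kk' E.
have {}E : (i * n + v)%:Z = (i' * n + v')%:Z /\ k = k' by rewrite !PoszD !PoszM; lia.
case: E => [[E] ->]; have n0 : (0 < n)%N by apply: leq_ltn_trans (ltn_ord v).
have Ei : i = i'.
  by have := congr1 (divn^~ n) E; rewrite !divnMDl // !divn_small // !addn0.
split=> //; apply: val_inj => /=; move: E; rewrite Ei; lia.
Qed.

Lemma cell_address_le (k : int) i v : 0 <= k -> cell_address k i v <= -10.
Proof. rewrite /cell_address; nia. Qed.

(** Cell 0 is excluded because it receives the answer. *)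
Definition input (m : memory) : Prop := forall z : int, 0 < z -> m z = m0 z.

(** The size bounds are imposed even when the flag is 0, since weight and count are stored in that
    case too. *)
Definition entry_ok (i : nat) (v : 'I_n) (m : memory) : Prop :=
  [/\ best G marked s (walk G s i v)
        (m (cell_address 0 i v)) (m (cell_address 1 i v)) (m (cell_address 2 i v)),
      `|m (cell_address 1 i v)| <= (i * A)%:Z &
      0 <= m (cell_address 2 i v) <= i.+1%:Z].

Definition filled (i v : nat) (m : memory) : Prop :=
  [/\ input m, m (-7) = (\sum_x S x)%N%:Z,
      forall j x, (j <= i)%N -> entry_ok j x m &
      forall x : 'I_n, (x < v)%N -> entry_ok i.+1 x m].

Lemma entry_ok_update i v m a z :
  (forall k : int, 0 <= k < 3 -> cell_address k i v <> a) ->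
  entry_ok i v m -> entry_ok i v (update m a z).
Proof. by move=> ne; rewrite /entry_ok !update_other //; apply: ne. Qed.

Lemma filled_scalar i v m a z :
  -10 < a <= 0 -> a <> -7 -> filled i v m -> filled i v (update m a z).
Proof.
move=> a10 a7 [inp tok rows row].
have ne (k : int) j x : 0 <= k < 3 -> cell_address k j x <> a.
  by move=> k3; have := @cell_address_le k j x; lia.
split.
- by move=> y y0; rewrite update_other ?inp //; lia.
- by rewrite update_other //; lia.
- by move=> j x ji; apply: entry_ok_update; [move=> k; apply: ne | apply: rows].
- by move=> x xv; apply: entry_ok_update; [move=> k; apply: ne | apply: row].
Qed.

Lemma input_update m a z : a <= 0 -> input m -> input (update m a z).
Proof. by move=> a0 inp y y0; rewrite update_other ?inp //; lia. Qed.

Lemma n_bitlen : (bitlen n%:Z <= B)%N.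
Proof. by apply: small_bitlen; lia. Qed.

Lemma count_tokens_ok : terminates n B count_tokens m0
  (fun m => [/\ input m, m (-7) = (\sum_x S x)%N%:Z & forall z : int, z <= -10 -> m z = 0]).
Proof.
apply/terminates_seq/terminates_store => /=; first by apply: small_bitlen; lia.
pose Inv u m := [/\ input m, m (-7) = (\sum_(x < n | (x < u)%N) S x)%N%:Z &
  forall z : int, z <= -10 -> m z = 0].
apply: (@terminates_for _ _ _ _ _ Inv); first exact: n_bitlen.
- by move=> u m [inp _ _]; rewrite inp.
- split.
  + by do 2!apply: input_update => //.
  + by rewrite update_other // update_same big_pred0.
  + by move=> z z10; rewrite !update_other ?m0_neg //; lia.
- move=> u m ltun [inp tok neg] mu; pose x := Ordinal ltun.
  have sumS : (\sum_(y < n | (y < u.+1)%N) S y =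
               \sum_(y < n | (y < u)%N) S y + S x)%N.
    rewrite (bigD1 x) /= ?ltnSn // addnC; congr (_ + _)%N; apply: eq_bigl => y.
    by rewrite -val_eqE /= ltnS ltn_neqAle andbC.
  have valS : m (-7) + m (5 + m (-3)) = (\sum_(y < n | (y < u.+1)%N) S y)%N%:Z.
    by rewrite mu tok inp ?(m0_S x) ?sumS //; lia.
  apply: terminates_store => /=; rewrite valS.
    apply: small_bitlen; rewrite ger0_norm // lez_nat.
    apply: leq_trans S_small.
    by rewrite [leqRHS](bigID (fun y : 'I_n => y < u.+1)%N) leq_addr.
  split; first by rewrite update_other.
  split.
  + by do 2!apply: input_update => //.
  + by rewrite update_other // update_same.
  + by move=> z z10; rewrite !update_other ?neg //; lia.
- move=> m [inp tok neg]; split=> //; rewrite tok; congr (Posz _).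
  by apply: eq_bigl => x; rewrite ltn_ord.
Qed.

Lemma first_row_ok m : input m -> m (-7) = (\sum_x S x)%N%:Z ->
  (forall z : int, z <= -10 -> m z = 0) -> terminates n B first_row m (filled 0 0).
Proof.
move=> inp tok neg.
have zero (k : int) i v : 0 <= k -> m (cell_address k i v) = 0.
  by move=> k0; apply: neg; apply: cell_address_le.
have as0 : - 10 - 0 - 3 * (0 * m 1 + m 2) = cell_address 0 0 s.
  by rewrite !inp ?m0_n ?m0_s.
apply: terminates_seq; apply: terminates_store => /=.
  by apply: small_bitlen; lia.
rewrite as0; set m1 := update _ _ _.
have inp1 : input m1 by apply: input_update => //; have := @cell_address_le 0 0 s isT; lia.
have as2 : - 10 - 2 - 3 * (0 * m1 1 + m1 2) = cell_address 2 0 s.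
  by rewrite !inp1 ?m0_n ?m0_s.
have ne (k k' : int) v v' : 0 <= k < 3 -> 0 <= k' < 3 -> k <> k' \/ v <> v' ->
    cell_address k 0 v <> cell_address k' 0 v'.
  by move=> k3 k3' kv /(cell_address_inj k3 k3')[? _ ?]; case: kv.
(* Both branches of the test leave a row 0 that fits this description. *)
suff row m2 : (forall z : int, -10 < z -> m2 z = m z) ->
    (forall (k : int) v, 0 <= k < 3 -> m2 (cell_address k 0 v) =
       if k == 0 then (v == s)%:Z else
       if k == 2 then ((v == s) && marked s)%:Z else 0) -> filled 0 0 m2.
  have tokE : m1 (5 + m1 2) = (S s)%:Z by rewrite !inp1 // ?m0_s ?m0_S //; lia.
  have low (k : int) v := @cell_address_le k 0 v.
  apply: terminates_if => /=; rewrite tokE => Ss.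
    apply: terminates_skip; apply: row => [z z10|k v k3].
      by rewrite /m1 update_other //; have := low 0 s isT; lia.
    have -> : marked s = false by rewrite /marked; lia.
    rewrite andbF if_same; case: eqP => [->|k0]; last first.
      by rewrite /m1 update_other ?zero //; [lia | apply: ne => //; left].
    have [->|vs] := eqVneq v s; first by rewrite /m1 update_same.
    by rewrite /m1 update_other ?zero //; apply: ne => //; right; apply/eqP.
  apply: terminates_store => /=; first by apply: small_bitlen; lia.
  rewrite as2; apply: row => [z z10|k v k3].
    by rewrite /m1 !update_other //; [have := low 0 s isT | have := low 2 s isT]; lia.
  have -> : marked s by rewrite /marked; lia.
  rewrite andbT; have [->|vs] := eqVneq v s; last first.
    have {}vs : v <> s by apply/eqP.
    transitivity (0 : int); last by case: (k == 0); case: (k == 2).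
    rewrite /m1 !update_other ?zero //; first by case/andP: k3.
    - by apply: ne => //; right.
    - by apply: ne => //; right.
  case: eqP => [->|k0].
    by rewrite /m1 update_other ?update_same //; apply: ne => //; left.
  case: eqP => [->|k2]; first by rewrite /m1 update_same.
  by rewrite /m1 !update_other ?zero //; try (apply: ne => //; left); lia.
move=> hi lo; split=> //.
- by move=> z z0; rewrite hi ?inp //; lia.
- by rewrite hi.
move=> j v; rewrite leqn0 => /eqP ->.
rewrite /entry_ok !lo // !eqxx /=.
have [->|vs] := eqVneq v s; last first.
  split=> //; left; split=> // p [_ /size0nil -> /= sv].
  by rewrite sv eqxx in vs.
split=> //; last by case: (marked s).
by have := best_walk0 G marked s s; rewrite eqxx.
Qed.
Definition located (i : nat) (x v : 'I_n) (m : memory) : Prop :=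
  filled i v m /\ [/\ m (-1) = i%:Z, m (-2) = v%:Z & m (-3) = x%:Z].

Lemma located_scalar i x v m a z :
  -10 < a < -3 -> a <> -7 -> located i x v m -> located i x v (update m a z).
Proof.
move=> a10 a7 [fm [m1 m2 m3]]; rewrite /located !update_other //; try lia.
by split=> //; apply: filled_scalar => //; lia.
Qed.

Lemma cell_update_scalar (k : int) i v m a z :
  0 <= k -> -10 < a -> update m a z (cell_address k i v) = m (cell_address k i v).
Proof. by move=> k0 a10; rewrite update_other //; have := cell_address_le i v k0; lia. Qed.

Lemma eval_table_address m (k : int) j (x : 'I_n) (e1 e2 : expr) : input m ->
  eval m e1 = j%:Z -> eval m e2 = x%:Z ->
  eval m (table_address k e1 e2) = cell_address k j x.
Proof. by move=> inp /= -> ->; rewrite inp ?m0_n. Qed.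

Lemma eval_table m (k : int) j (x : 'I_n) (e1 e2 : expr) : input m ->
  eval m e1 = j%:Z -> eval m e2 = x%:Z ->
  eval m (table k e1 e2) = m (cell_address k j x).
Proof. by move=> inp e1j e2x; congr m; apply: eval_table_address. Qed.

Lemma eval_table_located k i x v m : located i x v m ->
  eval m (table k (var (-1)) (var (-3))) = m (cell_address k i x).
Proof. by move=> [[inp _ _ _] [m1 _ m3]]; apply: eval_table. Qed.

Lemma eval_edge_address i x v m : located i x v m ->
  eval m (edge_address (var (-3)) (var (-2))) = 5 + n%:Z + 2 * (x%:Z * n%:Z + v%:Z).
Proof. by move=> [[inp _ _ _] [_ m2 m3]] /=; rewrite m3 m2 !inp ?m0_n. Qed.

Lemma eval_edge i x v m : located i x v m ->
  eval m (Cell (edge_address (var (-3)) (var (-2)))) = (edge G x v)%:Z.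
Proof.
move=> lm; have [[inp _ _ _] _] := lm; rewrite -m0_edge -inp; last by nia.
by rewrite -(eval_edge_address lm).
Qed.

Lemma eval_extended_weight i x v m : located i x v m -> edge G x v ->
  eval m (extended_weight f) = m (cell_address 1 i x) + weight G x v.
Proof.
move=> lm xv; have [[inp _ _ _] _] := lm.
rewrite -[LHS]/(eval m (table 1 (var (-1)) (var (-3))) +
  f * m (eval m (edge_address (var (-3)) (var (-2))) + 1)).
by rewrite (eval_table_located 1 lm) (eval_edge_address lm) [m (_ + 1)]inp ?m0_weight //; nia.
Qed.

(** The invariant of the loop over predecessors. Cell -6 omits the mark of [v], which is added only
    when the entry is written to the table. *)
Definition gathered (i u : nat) (v : 'I_n) (m : memory) : Prop :=
  [/\ filled i v m, m (-1) = i%:Z /\ m (-2) = v%:Z,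
      best G marked s (walk_via G s i u v) (m (-4)) (m (-5)) (m (-6) + (marked v)%:Z),
      `|m (-5)| <= (i.+1 * A)%:Z & 0 <= m (-6) <= i.+1%:Z].

Lemma gathered_scalar i u v m z :
  gathered i u v m -> gathered i u v (update m (-3) z).
Proof.
move=> [fm [m1 m2] bm w5 c6]; rewrite /gathered !update_other //.
by split=> //; apply: filled_scalar.
Qed.

Lemma set_entry_ok i (x v : 'I_n) m : (i < n)%N ->
  gathered i x v m -> m (-3) = x%:Z -> edge G x v ->
  m (cell_address 0 i x) = 1 ->
  m (-4) = 0 \/
    walk_key n (m (cell_address 1 i x) + weight G x v) (m (cell_address 2 i x))
      <= walk_key n (m (-5)) (m (-6)) ->
  terminates n B (set_entry f) m
    (fun m' => m' (-3) = x%:Z /\ gathered i x.+1 v (update m' (-3) x.+1%:Z)).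
Proof.
move=> ltin [fm [m1 m2] bm w5 c6] m3 xv fx le_key.
have [_ _ rows _] := fm; have [bx wx cx] := rows i x (leqnn _); rewrite fx in bx.
have lm : located i x v m by [].
have leA : (i * A + A <= n * A)%N by rewrite -mulSnr leq_mul2r ltin orbT.
have szw : `|m (cell_address 1 i x) + weight G x v| <= (i.+1 * A)%:Z.
  apply: le_trans (ler_normD _ _) _; rewrite mulSnr PoszD.
  by apply: lerD wx _; apply: weight_le.
apply: terminates_seq; apply: terminates_store.
  by apply: small_bitlen => /=; lia.
rewrite [eval _ (Const 1)]/= [eval _ (Const (-4))]/=.
have lma : located i x v (update m (-4) 1) by apply: located_scalar.
apply: terminates_seq; apply: terminates_store;
  rewrite (eval_extended_weight lma xv) cell_update_scalar //.
  apply: small_bitlen; apply: le_trans szw _; rewrite lez_nat mulSnr.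
  exact: leq_trans w_small.
rewrite [eval _ (Const _)]/=.
set mb := update _ (-5) _; have lmb : located i x v mb by apply: located_scalar.
have mb2 : mb (cell_address 2 i x) = m (cell_address 2 i x).
  by rewrite /mb !cell_update_scalar.
apply: terminates_store; rewrite (eval_table_located 2 lmb) mb2.
  by apply: small_bitlen; lia.
rewrite [eval _ (Const _)]/=.
set mc := update mb (-6) _.
have [fmc [mc1 mc2 mc3]] : located i x v mc by apply: located_scalar.
have mc4 : mc (-4) = 1 by rewrite /mc /mb 2?update_other // update_same.
have mc5 : mc (-5) = m (cell_address 1 i x) + weight G x v.
  by rewrite /mc update_other // /mb update_same.
have mc6 : mc (-6) = m (cell_address 2 i x) by rewrite /mc update_same.
split=> //; apply: gathered_scalar; split=> //; rewrite ?mc4 ?mc5 ?mc6 //.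
exact: best_relax_set bm bx le_key.
Qed.

Lemma relax_ok i (x v : 'I_n) m : (i < n)%N ->
  gathered i x v m -> m (-3) = x%:Z ->
  terminates n B (relax f) m
    (fun m' => m' (-3) = x%:Z /\ gathered i x.+1 v (update m' (-3) x.+1%:Z)).
Proof.
move=> ltin am m3; have [fm [m1 m2] bm w5 c6] := am.
have [inp _ rows _] := fm; have [bx wx cx] := rows i x (leqnn _).
have lm : located i x v m by [].
have te k := eval_table_located k lm.
have evM (e1 e2 : expr) : eval m (Mul e1 e2) = eval m e1 * eval m e2 by [].
have evB (e1 e2 : expr) : eval m (Sub e1 e2) = eval m e1 - eval m e2 by [].
have evD (e1 e2 : expr) : eval m (Add e1 e2) = eval m e1 + eval m e2 by [].
have evV k : eval m (var k) = m k by [].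
have evC k : eval m (Const k) = k by [].
apply: terminates_if; rewrite evM te (eval_edge lm) => tst.
  have xv : edge G x v by case: edge tst => //; rewrite mulr0.
  have fx : m (cell_address 0 i x) = 1 by case: (best_flag bx) tst => ->; rewrite ?mul0r.
  apply: terminates_if; rewrite evB evC evV => f4.
    by apply: set_entry_ok => //; left; case: (best_flag bm) f4 => ->.
  have {}f4 : m (-4) = 1 by case: (best_flag bm) f4 => ->.
  apply: terminates_if; rewrite evD evM evD !evB !evV evC te inp // m0_n
      (eval_extended_weight lm xv) => cmp.
    by apply: set_entry_ok => //; right; rewrite /walk_key; lia.
  apply: terminates_skip; split=> //; apply: gathered_scalar => //.
  split=> //; rewrite f4 in bm *; rewrite fx in bx.
  by apply: best_relax_keep bm bx _ => //; rewrite /walk_key; lia.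
(* The product of the flags vanishes: there is no walk to [x] or no edge from [x] to [v]. *)
apply: terminates_skip; split=> //; apply: gathered_scalar.
split=> //; apply: (best_relax_skip bm bx).
case: (best_flag bx) tst => ->; first by left.
by case: edge => //; right.
Qed.
Lemma filled_entry i (v x : 'I_n) k m z : 0 <= k < 3 ->
  filled i v m -> filled i v (update m (cell_address k i.+1 v) z).
Proof.
move=> k3 [inp tok rows row].
have low : cell_address k i.+1 v <= -10 by apply: cell_address_le; case/andP: k3.
split.
- by apply: input_update => //; apply: le_trans low _.
- by rewrite update_other // => E; move: low; rewrite -E.
- move=> j y ji; apply: entry_ok_update; last exact: rows.
  by move=> k' k3' /(cell_address_inj k3' k3)[_ E _]; rewrite E ltnn in ji.
- move=> y yv; apply: entry_ok_update; last exact: row.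
  by move=> k' k3' /(cell_address_inj k3' k3)[_ _ E]; rewrite E ltnn in yv.
Qed.

Lemma filled_next i (v : 'I_n) m :
  filled i v m -> entry_ok i.+1 v m -> filled i v.+1 m.
Proof.
move=> [inp tok rows row] new; split=> // x.
by rewrite ltnS leq_eqVlt => /orP[/eqP/val_inj ->|/row].
Qed.

Lemma compute_entry_ok i (v : 'I_n) m : (i < n)%N ->
  filled i v m -> m (-1) = i%:Z -> m (-2) = v%:Z ->
  terminates n B (compute_entry f) m
    (fun m' => [/\ filled i v.+1 m', m' (-1) = i%:Z & m' (-2) = v%:Z]).
Proof.
move=> ltin fm m1 m2.
apply: terminates_seq; apply: terminates_store; first by apply: small_bitlen => /=; lia.
apply: terminates_seq; apply: terminates_store; first by apply: small_bitlen => /=; lia.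
apply: terminates_seq; apply: terminates_store; first by apply: small_bitlen => /=; lia.
apply: terminates_seq.
rewrite [eval _ (Const 0)]/= [eval _ (Const (-4))]/=
  [eval _ (Const (-5))]/= [eval _ (Const (-6))]/=.
set ma := update _ (-6) _.
apply: (@terminates_for _ _ _ _ _ (fun u m => gathered i u v m)); first exact: n_bitlen.
- by move=> u m' [[inp _ _ _] _ _ _ _]; rewrite inp.
- apply: gathered_scalar; rewrite /gathered.
  have -> : ma (-4) = 0 by rewrite /ma 2?update_other // update_same.
  have -> : ma (-5) = 0 by rewrite /ma update_other // update_same.
  have -> : ma (-6) = 0 by rewrite /ma update_same.
  rewrite /ma !update_other //; split=> //.
    by do 3!apply: filled_scalar => //.
  exact: best_via0.
- by move=> u m' ltun am mu; apply: (@relax_ok i (Ordinal ltun) v m').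
move=> mb [fb [mb1 mb2] /best_via_all bb w5 c6]; have [inpb _ _ _] := fb.
have adr k m' : filled i v m' -> m' (-1) = i%:Z -> m' (-2) = v%:Z ->
    eval m' (next_row_address k) = cell_address k i.+1 v.
  move=> [inp' _ _ _] m'1 m'2; apply: eval_table_address => //=.
  by rewrite m'1 addrC -intS.
have low k : 0 <= k -> cell_address k i.+1 v <= -10 by apply: cell_address_le.
have scal k z m' w : 0 <= k -> -10 < z -> update m' (cell_address k i.+1 v) w z = m' z.
  by move=> k0 z10; rewrite update_other // => E; have := low k k0; rewrite -E; lia.
have ne k k' : 0 <= k < 3 -> 0 <= k' < 3 -> k <> k' ->
    cell_address k i.+1 v <> cell_address k' i.+1 v.
  by move=> k3 k3' kk /(cell_address_inj k3 k3')[].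
apply: terminates_seq; apply: terminates_store; rewrite [eval _ (var _)]/=.
  by apply: small_bitlen; case: (best_flag bb) => ->; lia.
rewrite adr //; set mc := update _ _ _.
have fc : filled i v mc by apply: filled_entry.
have [mc1 mc2] : mc (-1) = i%:Z /\ mc (-2) = v%:Z by rewrite /mc !scal.
have [mc5 mc6] : mc (-5) = mb (-5) /\ mc (-6) = mb (-6) by rewrite /mc !scal.
apply: terminates_seq; apply: terminates_store; rewrite [eval _ (var _)]/= mc5.
  apply: small_bitlen; apply: le_trans w5 _; rewrite lez_nat.
  by apply: leq_trans w_small; rewrite leq_mul2r ltin orbT.
rewrite adr //; set md := update _ _ _.
have fd : filled i v md by apply: filled_entry.
have [md1 md2] : md (-1) = i%:Z /\ md (-2) = v%:Z by rewrite /md !scal.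
have md6 : md (-6) = mb (-6) by rewrite /md scal.
have tok : eval md (token_at (var (-2))) = (S v)%:Z.
  have [inp _ _ _] := fd; rewrite -m0_S -inp; last by lia.
  by rewrite /= md2.
(* Both branches of the last test store this count, now including [v]. *)
have last_store c : c = mb (-6) + (marked v)%:Z ->
    [/\ filled i v.+1 (update md (cell_address 2 i.+1 v) c),
      update md (cell_address 2 i.+1 v) c (-1) = i%:Z &
      update md (cell_address 2 i.+1 v) c (-2) = v%:Z].
  move=> cE; rewrite !scal //; split=> //; apply: filled_next.
    exact: filled_entry.
  rewrite /entry_ok update_same update_other; last exact: ne.
  rewrite {1}/md {1}/mc update_other; last exact: ne.
  rewrite update_same update_other; last exact: ne.
  rewrite /md update_same cE; split=> //.
  by case: (marked v); lia.
apply: terminates_if; rewrite tok => Sv; apply: terminates_store.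
- by rewrite [eval _ _]/= md6; apply: small_bitlen; lia.
- rewrite adr // [eval _ (var _)]/= md6; apply: last_store.
  have -> : marked v = false by rewrite /marked; lia.
  by rewrite addr0.
- by rewrite [eval _ _]/= md6; apply: small_bitlen; lia.
rewrite adr // [eval _ (Add _ _)]/= md6; apply: last_store.
by have -> : marked v by rewrite /marked; lia.
Qed.

Lemma fill_table_ok m : filled 0 0 m -> terminates n B (fill_table f) m (filled n 0).
Proof.
move=> f0; apply: (@terminates_for _ _ _ _ _ (fun i m => filled i 0 m)).
- exact: n_bitlen.
- by move=> i m' [inp _ _ _]; rewrite inp.
- exact: filled_scalar.
- move=> i m' ltin fm m1.
  pose Inv v m := filled i v m /\ m (-1) = i%:Z.
  apply: (@terminates_for _ _ _ _ _ Inv); first exact: n_bitlen.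
  + by move=> v m'' [[inp _ _ _] _]; rewrite inp.
  + by split; [apply: filled_scalar | rewrite update_other].
  + move=> v mv ltvn [fv mv1] mv2.
    have := @compute_entry_ok i (Ordinal ltvn) mv ltin fv mv1 mv2.
    apply: terminates_imp => mw [fw mw1 mw2].
    by split=> //; split; [apply: filled_scalar | rewrite update_other].
  (* A row [i + 1] complete up to [n] joins the finished rows. *)
  + move=> mw [[inp tok rows row] mw1]; split=> //; apply: filled_scalar => //.
    split=> // j x; rewrite leq_eqVlt => /orP[/eqP ->|]; first exact: row.
    by rewrite ltnS => /rows.
- by [].
Qed.

(* For [k] = 0, 1, 2, [T k] is the column of flags, weights, marks of [t]. *)
Definition target_column (T : int -> nat -> int) (m : memory) : Prop :=
  forall k j, 0 <= k -> m (cell_address k j t) = T k j.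

Lemma target_column_scalar T m a z :
  -10 < a -> target_column T m -> target_column T (update m a z).
Proof. by move=> a10 mT k j k0; rewrite cell_update_scalar // mT. Qed.

Lemma eval_target T k j m : input m -> target_column T m -> m (-1) = j%:Z -> 0 <= k ->
  eval m (table k (var (-1)) (var 3)) = T k j.
Proof.
by move=> inp mT m1 k0; rewrite -mT //; apply: eval_table => //=; rewrite inp.
Qed.

Definition is_minimum (T : int -> nat -> int) (i : nat) (g d : int) : Prop :=
  [/\ g = 0 \/ g = 1, g = 0 -> forall j, (j < i)%N -> T 0 j <> 1,
      g = 1 -> exists j, [/\ (j < i)%N, T 0 j = 1 & d = T 1 j] &
      g = 1 -> forall j, (j < i)%N -> T 0 j = 1 -> d <= T 1 j].

Lemma minimum_weight_ok T m : filled n 0 m -> target_column T m ->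
  terminates n B minimum_weight m
    (fun m' => [/\ filled n 0 m', target_column T m' & is_minimum T n (m' (-8)) (m' (-9))]).
Proof.
move=> fm mT; apply: terminates_seq; apply: terminates_store.
  by apply: small_bitlen => /=; lia.
rewrite /=.
pose Inv i m := [/\ filled n 0 m, target_column T m & is_minimum T i (m (-8)) (m (-9))].
apply: (@terminates_for _ _ _ _ _ Inv) => //; first exact: n_bitlen.
- by move=> i m' [[inp _ _ _] _ _]; rewrite inp.
- split; [by do 2!apply: filled_scalar => //|by do 2!apply: target_column_scalar => //|].
  by rewrite update_other // update_same; split=> //; left.
move=> i ma ltin [fa aT ia] ma1; have [inp _ rows _] := fa.
have te k := eval_target inp aT ma1 (k := k).
have [bi wi _] := rows i t (ltnW ltin); rewrite !aT // in bi wi.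
have Ti := best_flag bi.
have step m' : filled n 0 m' -> target_column T m' -> m' (-1) = i%:Z ->
    is_minimum T i.+1 (m' (-8)) (m' (-9)) ->
    m' (-1) = i%:Z /\ Inv i.+1 (update m' (-1) i.+1%:Z).
  move=> *; split=> //; split; [exact: filled_scalar|exact: target_column_scalar|].
  by rewrite !update_other.
have [g01 g0 g1 gmin] := ia.
(* The minimum is stored in two cases: for the first flagged row, where the premise on weights is
   vacuous, and for a smaller weight. *)
have store_ok : T 0 i = 1 -> (ma (-8) = 1 -> T 1 i <= ma (-9)) ->
    terminates n B store_minimum ma
      (fun m' => m' (-1) = i%:Z /\ Inv i.+1 (update m' (-1) i.+1%:Z)).
  move=> Ti1 le_d; apply: terminates_seq; apply: terminates_store.
    by apply: small_bitlen => /=; lia.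
  rewrite [eval _ (Const 1)]/= [eval _ (Const _)]/=.
  set mb := update _ _ _.
  have fb : filled n 0 mb by apply: filled_scalar.
  have bT : target_column T mb by apply: target_column_scalar.
  have mb1 : mb (-1) = i%:Z by rewrite /mb update_other.
  have [inpb _ _ _] := fb.
  apply: terminates_store; rewrite (eval_target inpb bT mb1) //.
    apply: small_bitlen; apply: le_trans wi _; rewrite lez_nat.
    by apply: leq_trans w_small; rewrite leq_mul2r ltnW ?orbT.
  rewrite [eval _ (Const _)]/=; apply: step;
    [exact: filled_scalar|exact: target_column_scalar|by rewrite update_other|].
  rewrite update_same update_other // /mb update_same; split=> //; first by right.
    by exists i.
  move=> _ j; rewrite ltnS leq_eqVlt => /orP[/eqP -> //|ji Tj].
  case: g01 => [/g0 /(_ j ji) //|g]; apply: le_trans (le_d g) _; exact: gmin.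
apply: terminates_if; rewrite te // => T0.
  have Ti1 : T 0 i = 1 by case: Ti T0 => ->.
  apply: terminates_if => /= g8.
    by apply: store_ok => // g; rewrite g in g8.
  have {}g8 : ma (-8) = 1 by case: g01 g8 => ->.
  apply: terminates_if; rewrite -/(eval ma (Sub _ _)).
    rewrite (_ : eval ma _ = ma (-9) - T 1 i) => [cmp|]; last by rewrite -te.
    by apply: store_ok => // _; lia.
  rewrite (_ : eval ma _ = ma (-9) - T 1 i) => [cmp|]; last by rewrite -te.
  apply: terminates_skip; apply: step => //; split=> //; rewrite ?g8 //.
    by move=> _; have [j [ji]] := g1 g8; exists j; split=> //; apply: leqW.
  move=> _ j; rewrite ltnS leq_eqVlt => /orP[/eqP ->|ji Tj]; first by lia.
  exact: gmin.
have {}T0 : T 0 i = 0 by case: Ti T0 => ->.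
apply: terminates_skip; apply: step => //; split=> //.
- move=> /g0 no j; rewrite ltnS leq_eqVlt => /orP[/eqP -> |/no //]; by rewrite T0.
- by move=> /g1[j [ji]]; exists j; split=> //; apply: leqW.
- move=> /gmin mn j; rewrite ltnS leq_eqVlt => /orP[/eqP -> |/mn //]; by rewrite T0.
Qed.

Definition accepts (T : int -> nat -> int) (d : int) (j : nat) : Prop :=
  [/\ T 0 j = 1, T 1 j <= d, T 2 j <= b & (j < \sum_x S x)%N].

Lemma decide_ok T m : filled n 0 m -> target_column T m ->
  terminates n B decide m (fun m' =>
    m' 0 = 0 /\ (forall j, (j < n)%N -> ~ accepts T (m (-9)) j) \/
    m' 0 = 1 /\ (exists2 j, (j < n)%N & accepts T (m (-9)) j)).
Proof.
move=> fm mT; apply: terminates_seq; apply: terminates_store.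
  by apply: small_bitlen => /=; lia.
rewrite /=; set d := m (-9).
pose Res i (z : int) := z = 0 /\ (forall j, (j < i)%N -> ~ accepts T d j) \/
    z = 1 /\ (exists2 j, (j < i)%N & accepts T d j).
pose Inv i m := [/\ filled n 0 m, target_column T m, m (-9) = d & Res i (m 0)].
apply: (@terminates_for _ _ _ _ _ Inv) => //; first exact: n_bitlen.
- by move=> i m' [[inp _ _ _] _ _ _]; rewrite inp.
- split; [by do 2!apply: filled_scalar => //|by do 2!apply: target_column_scalar => //| |].
    by rewrite !update_other.
  by rewrite update_other // update_same; left.
- move=> i ma ltin [fa aT ad ra] ma1; have [inp tok rows _] := fa.
  have te k := eval_target inp aT ma1 (k := k).
  have [bi _ _] := rows i t (ltnW ltin); rewrite !aT // in bi.
  have Ti := best_flag bi.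
  (* Every failed test rejects row [i], and then the answer so far stands. *)
  have skip : ~ accepts T d i -> terminates n B Skip ma
      (fun m' => m' (-1) = i%:Z /\ Inv i.+1 (update m' (-1) i.+1%:Z)).
    move=> no; apply: terminates_skip; split=> //.
    split; [exact: filled_scalar|exact: target_column_scalar| |]; rewrite update_other //.
    case: ra => [[z0 nacc]|[z1 [j ji acc]]]; [left|right]; split=> //.
      by move=> j; rewrite ltnS leq_eqVlt => /orP[/eqP -> |/nacc].
    by exists j => //; apply: leqW.
  have evB (e1 e2 : expr) : eval ma (Sub e1 e2) = eval ma e1 - eval ma e2 by [].
  have evV k : eval ma (var k) = ma k by [].
  apply: terminates_if; rewrite te // => T0; last first.
    by apply: skip => -[T1]; rewrite T1 in T0.
  apply: terminates_if; rewrite evB te // evV ad => T1.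
    by apply: skip => -[_ ? _ _]; lia.
  apply: terminates_if; rewrite evB te // evV inp // m0_b => T2.
    by apply: skip => -[_ _ ? _]; lia.
  apply: terminates_if; rewrite evB !evV tok ma1 => T3; last first.
    by apply: skip => -[_ _ _]; rewrite -ltz_nat; lia.
  apply: terminates_store; first by apply: small_bitlen => /=; lia.
  rewrite /=; split; first by rewrite update_other.
  split; [by do 2!apply: filled_scalar => //|by do 2!apply: target_column_scalar => //| |].
    by rewrite !update_other.
  rewrite update_other // update_same; right; split=> //; exists i => //.
  split=> //; [by case: Ti T0 => -> | by lia | by lia |by rewrite -ltz_nat; lia].
- by move=> m' [].
Qed.

Hypothesis nonneg : no_negative_cycle G.

Let discoverable : Prop := exists2 p, shortest_st_path G s t p &
  (size p < \sum_x S x)%N /\ num_marked marked s p <= b.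

Lemma discovery_program_ok : terminates n B (discovery_program f) m0
  (fun m => (discoverable -> m 0 = 1) /\ (~ discoverable -> m 0 = 0)).
Proof.
apply: terminates_seq; apply: terminates_imp count_tokens_ok => m1 [inp1 tok1 neg1].
apply: terminates_seq; apply: terminates_imp (first_row_ok inp1 tok1 neg1) => m2 f2.
apply: terminates_seq; apply: terminates_imp (fill_table_ok f2) => m3 f3.
pose T k j := m3 (cell_address k j t).
have T3 : target_column T m3 by [].
apply: terminates_seq; apply: terminates_imp (minimum_weight_ok f3 T3).
move=> m4 [f4 T4 [g01 g0 g1 gmin]]; apply: terminates_imp (decide_ok f4 T4) => m5.
have rows i : (i < n)%N -> best G marked s (walk G s i t) (T 0 i) (T 1 i) (T 2 i).
  by move=> ltin; have [_ _ rows _] := f3; have [] := rows i t (ltnW ltin).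
have d_le i : (i < n)%N -> T 0 i = 1 -> m4 (-9) <= T 1 i.
  move=> ltin Ti; case: g01 => [/g0 /(_ i ltin) //|/gmin]; exact.
have d_eq : (forall i, (i < n)%N -> T 0 i <> 1) \/
    exists i, [/\ (i < n)%N, T 0 i = 1 & m4 (-9) = T 1 i].
  by case: g01 => [/g0|/g1]; [left|right].
have dE := rows_shortest_st_path nonneg rows (\sum_x S x) b d_le d_eq.
(* [accepts] asks for weight at most [d], which amounts to equality because [d] is a lower bound. *)
have accE : (exists2 j, (j < n)%N & accepts T (m4 (-9)) j) <-> discoverable.
  split=> [[j ltjn [Tj Wj Cj jS]]|/dE[j [ltjn Tj Wj Cj jS]]].
    by apply/dE; exists j; split=> //; apply/le_anti; rewrite Wj d_le.
  by exists j => //; split=> //; rewrite Wj.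
case=> [[-> no]|[-> yes]]; split=> // H.
  by move: H => /accE[j /no].
by case: H; apply/accE.
Qed.
End Program.

(** * The encoding *)

Lemma nth_flatten_const (T : Type) (x0 : T) (k : nat) (ss : seq (seq T)) (i j : nat) :
  all (fun r => size r == k) ss -> (j < k)%N ->
  nth x0 (flatten ss) (i * k + j) = nth x0 (nth [::] ss i) j.
Proof.
move=> + ltjk; elim: ss i => [|r ss IH] i /=; first by rewrite !nth_nil.
case/andP=> /eqP rk ssk; rewrite nth_cat rk; case: i => [|i]; first by rewrite ltjk.
by rewrite mulSn -addnA ltnNge leq_addr /= addKn IH.
Qed.

Lemma size_flatten_const (T : Type) (k : nat) (ss : seq (seq T)) :
  all (fun r => size r == k) ss -> size (flatten ss) = (size ss * k)%N.
Proof.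
by elim: ss => //= r ss IH /andP[/eqP rk /IH zs]; rewrite size_cat rk zs mulSn.
Qed.

Section EncodeGraph.
Variables (n : nat) (G : wdigraph 'I_n).

Let pair_code (x y : 'I_n) : seq int :=
  if edge G x y then [:: 1; weight G x y] else [:: 0; 0].

Let pair_codes := [seq pair_code x y | x <- enum 'I_n, y <- enum 'I_n].

Let size_rows :
  all (fun r => size r == n) [seq [seq pair_code x y | y <- enum 'I_n] | x <- enum 'I_n].
Proof. by apply/allP => _ /mapP[x _ ->]; rewrite size_map size_enum_ord. Qed.

Let size_codes : all (fun r => size r == 2) pair_codes.
Proof.
by apply/allP => _ /allpairsP[xy [_ _ ->]]; rewrite /pair_code; case: ifP.
Qed.

Lemma size_encode_graph : size (encode_graph G) = (n * n * 2)%N.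
Proof.
rewrite (size_flatten_const size_codes) (size_flatten_const size_rows).
by rewrite size_map size_enum_ord.
Qed.

(** The encoding flattens twice: rows of [n] codes, then codes of length 2. *)
Lemma nth_encode_graph (x y : 'I_n) (j : nat) : (j < 2)%N ->
  (encode_graph G)`_((x * n + y) * 2 + j) = (pair_code x y)`_j.
Proof.
move=> lej; rewrite (nth_flatten_const _ _ size_codes) //.
rewrite (nth_flatten_const _ _ size_rows) //.
by rewrite (nth_map x) ?size_enum_ord // (nth_map y) ?size_enum_ord // !nth_ord_enum.
Qed.

End EncodeGraph.

Lemma input_size_ge (w : seq int) (z : int) : z \in w -> (bitlen z <= input_size w)%N.
Proof.
rewrite /input_size; elim: w => //= y w IH; rewrite inE => /orP[/eqP ->|/IH]; lia.
Qed.

Lemma size_le_input_size (w : seq int) : (size w <= input_size w)%N.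
Proof. by rewrite /input_size; elim: w => //= y w; rewrite /bitlen; lia. Qed.

(** Every entry takes at least one bit, so the length in cell 0 is at most the input size. A zero
    cell takes one bit as well, hence the nonempty input. *)
Lemma bitlen_initial_memory (w : seq int) (z : int) : w <> [::] ->
  (bitlen (initial_memory w z) <= input_size w)%N.
Proof.
move=> w0; have lew := size_le_input_size w.
have L0 : (0 < input_size w)%N by case: w w0 lew => //= ? ? _; apply: leq_trans.
have b0 : (bitlen 0 <= input_size w)%N by [].
case: z => [[|i]|i] //=.
  by rewrite bitlen_leP //; apply: leq_ltn_trans lew (ltn_expl _ _).
have [lti|gei] := ltnP i (size w); last by rewrite nth_default.
by apply/input_size_ge/mem_nth.
Qed.

Section EncodeInstance.
Variable I : instance.
Let n := num_vertices I.
Let m0 := initial_memory (encode I).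

Let size_tokens : size [seq Posz (tokens I x) | x <- enum 'I_n] = n.
Proof. by rewrite size_map size_enum_ord. Qed.

(** The vector of multiplicities has one entry per vertex, so [n] itself, and not just its bit
    length, is at most the input size. *)
Lemma num_vertices_input_size : (n + 4 <= input_size (encode I))%N.
Proof.
apply: leq_trans (size_le_input_size _).
by rewrite /encode size_cat size_cat size_tokens /=; lia.
Qed.

Lemma initial_memory_token (x : 'I_n) : m0 (5 + x%:Z) = (multiplicity (tokens I) x)%:Z.
Proof.
rewrite -PoszD /m0 /= add0n nth_cat size_tokens ltn_ord.
by rewrite (nth_map x) ?size_enum_ord // nth_ord_enum.
Qed.

Lemma initial_memory_graph (x y : 'I_n) (j : nat) : (j < 2)%N ->
  m0 (5 + n%:Z + 2 * (x%:Z * n%:Z + y%:Z) + j%:Z) =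
  (if edge (problem_graph I) x y then [:: 1; weight (problem_graph I) x y]
   else [:: 0; 0])`_j.
Proof.
move=> ltj.
have -> : 5 + n%:Z + 2 * (x%:Z * n%:Z + y%:Z) + j%:Z =
    Posz (5 + (n + ((x * n + y) * 2 + j))) by rewrite !(PoszD, PoszM); ring.
rewrite /m0 /= add0n nth_cat size_tokens ltnNge leq_addr /= addKn nth_cat.
(* The index stays within the block of the problem graph, ahead of the movement graph. *)
rewrite size_encode_graph; have -> : ((x * n + y) * 2 + j < n * n * 2)%N.
  have [ltx lty] := (ltn_ord x, ltn_ord y).
  have : (x.+1 * n <= n * n)%N by rewrite leq_mul2r ltx orbT.
  by rewrite mulSn; lia.
exact: nth_encode_graph.
Qed.

End EncodeInstance.

(** * Both problems as weighted path problems *)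

Definition scale_weight (V : finType) (f : int) (G : wdigraph V) : wdigraph V :=
  WDigraph (edge G) (fun x y => f * weight G x y).

Lemma walk_weight_scale (V : finType) (f : int) (G : wdigraph V) x p :
  walk_weight (scale_weight f G) x p = f * walk_weight G x p.
Proof. by elim: p x => [|y p IH] x /=; rewrite ?mulr0 // IH mulrDr. Qed.

Lemma scale_no_negative_cycle (V : finType) (f : int) (G : wdigraph V) :
  0 <= f -> no_negative_cycle G -> no_negative_cycle (scale_weight f G).
Proof.
move=> f0 nonneg [|x p] // cyc.
by rewrite /cycle_weight walk_weight_scale mulr_ge0 //; apply: nonneg cyc.
Qed.

Definition scaled_discovery (f : int) (I : instance) : Prop :=
  exists2 T, reachable (movement_graph I) (tokens I) (budget I) T &
  exists2 p, shortest_st_path (scale_weight f (problem_graph I)) (source I) (target I) p &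
             {subset source I :: p <= T}.

Lemma scaled_discoveryE f I : token_jumping I ->
  scaled_discovery f I <->
  exists2 p, shortest_st_path (scale_weight f (problem_graph I)) (source I) (target I) p &
    (size p < \sum_x multiplicity (tokens I) x)%N /\
    num_marked (fun x => multiplicity (tokens I) x == 0%N) (source I) p <= budget I.
Proof.
move=> jumping.
have mark p : num_marked (fun x => multiplicity (tokens I) x == 0%N) (source I) p =
    (count (fun x => x \notin tokens I) (source I :: p))%:Z.
  by congr Posz; apply: eq_count => x; rewrite mem_mset -eqn0Ngt.
split=> [[T reach [p sp pT]]|[p sp [szp cp]]].
  have [[_ Up _] _] := sp; exists p => //.
  by rewrite mark; apply/(reachable_cover jumping _ _ Up); exists T.
have [[_ Up _] _] := sp; rewrite mark in cp.
have [T reach pT] := (reachable_cover jumping (tokens I) (budget I) Up).2 (conj szp cp).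
by exists T => //; exists p.
Qed.

Lemma scaled_discovery_ptime (f : int) : f = 0 \/ f = 1 ->
  solvable_in_ptime encode token_jumping (scaled_discovery f).
Proof.
move=> f01.
(* The polynomial is fixed before the instance: [L] bounds the number of iterations and [2 * L] the
   bits of a cell. *)
have [p timeP] : poly_bounded (fun L => cmd_time L (2 * L) (discovery_program f)).
  apply: poly_bounded_cmd_time poly_bounded_id _.
  exact: poly_boundedM (poly_bounded_cst 2) poly_bounded_id.
exists (discovery_program f), p => I jumping.
set L := input_size (encode I); set n := num_vertices I.
have leL : (n + 4 <= L)%N := num_vertices_input_size I.
have enc0 : encode I <> [::] by [].
have memL z : (bitlen (initial_memory (encode I) z) <= L)%N by apply: bitlen_initial_memory.
have mem_lt z : (`|initial_memory (encode I) z| < 2 ^ L)%N.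
  by apply: leq_trans (ltn_bitlen _) _; rewrite leq_exp2l.
have graph := @initial_memory_graph I.
have f0 : 0 <= f by case: f01 => ->.
have nneg := scale_no_negative_cycle f0 (@problem_graphP I).
(* Input entries are below [2 ^ L] in absolute value, so sums of at most [n <= L] of them are
   bounded by [L * 2 ^ L], which is less than [2 ^ (2 * L)]. *)
have := @discovery_program_ok n (scale_weight f (problem_graph I)) f (source I) (target I)
  (budget I) (multiplicity (tokens I)) (initial_memory (encode I))
  (2 ^ L) (L * 2 ^ L) (2 * L).
case=> //.
- exact: initial_memory_token.
- move=> x y; rewrite -[X in initial_memory _ X]addr0 (graph x y 0%N) //=.
  by case: edge.
- by move=> x y /= xy; have := graph x y 1%N isT; rewrite xy => E; congr (_ * _); apply: E.
- by case.
- move=> x y /= xy; have := mem_lt (5 + n%:Z + 2 * (x%:Z * n%:Z + y%:Z) + 1%:Z).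
  by rewrite (graph x y 1%N) // xy /=; case: f01 => ->; rewrite ?mul0r ?mul1r; lia.
- have := expn_gt0 2 L; nia.
- by rewrite leq_mul2r; apply/orP; right; lia.
- apply: (@leq_trans (\sum_(x < n) 2 ^ L)).
    apply: leq_sum => x _; have := mem_lt (5 + x%:Z).
    by rewrite initial_memory_token /= => /ltnW.
  by rewrite sum_nat_const card_ord leq_mul2r; apply/orP; right; lia.
- by rewrite mul2n -addnn expnD ltn_mul2r expn_gt0 ltn_expl.
- by move=> z; apply: leq_trans (memL z) _; lia.
move=> m [k [ex _ kT [yes no]]]; exists m, k; split=> //.
- apply: leq_trans kT _; apply: leq_trans (timeP L); apply: cmd_time_mono; lia.
- by move=> /(scaled_discoveryE f jumping)/yes.
- by move=> nQ; apply: no => /(scaled_discoveryE f jumping).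
Qed.

Lemma solvable_in_ptime_iff (A : Type) (enc : A -> seq int) (D Q Q' : A -> Prop) :
  (forall x, Q x <-> Q' x) -> solvable_in_ptime enc D Q -> solvable_in_ptime enc D Q'.
Proof.
move=> QQ' [c [p solve]]; exists c, p => x Dx.
have [m [k [ex kp yes no]]] := solve x Dx.
by exists m, k; split=> // [/QQ'|nQ]; [|apply: no => /QQ'].
Qed.

Lemma shortest_st_path_scale0 (V : finType) (G : wdigraph V) s t p :
  shortest_st_path (scale_weight 0 G) s t p <-> st_path G s t p.
Proof.
by split=> [[]|stp] //; split=> // q _; rewrite !walk_weight_scale !mul0r.
Qed.

Lemma shortest_st_path_scale1 (V : finType) (G : wdigraph V) s t p :
  shortest_st_path (scale_weight 1 G) s t p <-> shortest_st_path G s t p.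
Proof.
by split=> -[stp min]; split=> // q /min; rewrite !walk_weight_scale !mul1r.
Qed.

Theorem theorem3 :
  solvable_in_ptime encode token_jumping path_discovery /\
  solvable_in_ptime encode token_jumping shortest_path_discovery.
Proof.
split; [apply: solvable_in_ptime_iff (scaled_discovery_ptime (or_introl erefl))
       |apply: solvable_in_ptime_iff (scaled_discovery_ptime (or_intror erefl))] => I;
  split=> -[T reach [p sp pT]]; exists T => //; exists p => //.
- exact/shortest_st_path_scale0.
- exact/shortest_st_path_scale0.
- exact/shortest_st_path_scale1.
- exact/shortest_st_path_scale1.
Qed.
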